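(* Let $\rho\in(0,1)$ and $R>0$ be fixed, let $i,j\in\{1,\dots,\mathcal{S}\}$, and put $g_N(w)=\min\{1,e^{-N(w-\rho R)}\}$ and $g(w)=\mathbf{1}_{(-\infty,\rho R]}(w)$. Suppose that a message is transmitted over the $\mathcal{S}$-state fading channel in the rare-transition regime, using the random coding scheme, as described in the context. Then the approximate upper bound $$P_{\mathrm{e},S_N|S_0}(j|i) \lesssim \int_{b_{\mathcal{S}}(\rho)}^{b_1(\rho)} \min\left\{1,e^{-N(w-\rho R)}\right\}\, dG_{j|i}(w)$$ holds in the following sense: for every $N$ (with $e^{NR}$ an integer), $$P_{\mathrm{e},S_N|S_0}(j|i) \leq \int_{[b_{\mathcal{S}}(\rho),\,b_1(\rho)]} g_N\, dG_{N,j|i},$$ and $$\lim_{N\to\infty}\int_{[b_{\mathcal{S}}(\rho),\,b_1(\rho)]} g_N\, dG_{N,j|i} = \lim_{N\to\infty}\int_{[b_{\mathcal{S}}(\rho),\,b_1(\rho)]} g_N\, dG_{j|i} = \int_{[b_{\mathcal{S}}(\rho),\,b_1(\rho)]} g\, dG_{j|i}.$$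
   Context: Continuous-time chain: $\mathcal{X}(t)$, $t\ge 0$, is a time-homogeneous (right-continuous) continuous-time Markov chain on $\{1,\dots,\mathcal{S}\}$ with generator matrix $\mathbf{Q}$. For $N\ge1$ its sampled version is $\mathcal{X}_N(t)=\mathcal{X}(\lfloor Nt\rfloor/N)$. Channel (rare-transition regime): for block length $N$, the channel states are $S_n=\mathcal{X}(n/N)$, $n=0,1,\dots,N$, a Markov chain with transition matrix $\mathbf{P}_N=\exp(\mathbf{Q}/N)$. Inputs and outputs are binary; at time $n\in\{1,\dots,N\}$, given $S_{n-1}=s$, the output $Y_n$ differs from the input $X_n$ with probability $\varepsilon_s$ and equals it with probability $1-\varepsilon_s$, independently across $n$ given the inputs and states; state evolution is independent of the inputs. Assume $\varepsilon_1<\varepsilon_2<\cdots<\varepsilon_{\mathcal{S}}\le \tfrac12$. Random coding: the code has $M=e^{NR}$ codewords of length $N$ ($R$ in nats per code bit), drawn independently with i.i.d. uniform bits, independently of the channel. The transmitted message index is independent of the codebook and the channel. The receiver knows the codebook and the state sequence and uses maximum-likelihood decoding; decoding failure means that the decoded index differs from the transmitted one. $P_{\mathrm{e},S_N|S_0}(j|i)$ is the probability, over the codebook and the channel, that decoding fails and $S_N=j$, given $S_0=i$. Coefficients: $b_k(\rho) = -\ln\Big[ 2^{-\rho}\big(\varepsilon_k^{\frac{1}{1+\rho}}+(1-\varepsilon_k)^{\frac{1}{1+\rho}}\big)^{1+\rho}\Big]$, so that $b_1(\rho)>\cdots>b_{\mathcal{S}}(\rho)$. Occupation times and weighted sums: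 $\eta_k=\int_0^1\mathbf{1}_{\{\mathcal{X}(t)=k\}}dt$, $\eta_{N,k}=\int_0^1\mathbf{1}_{\{\mathcal{X}_N(t)=k\}}dt$, $W(\rho)=\sum_{k=1}^{\mathcal{S}}\eta_k b_k(\rho)$, $W_N(\rho)=\sum_{k=1}^{\mathcal{S}}\eta_{N,k}b_k(\rho)$. Measures: $G_{j|i}$ and $G_{N,j|i}$ are the (sub-probability) measures on $\mathbb{R}$ with distribution functions $G_{j|i}(w)=\Pr(W(\rho)\le w,\ \mathcal{X}(1)=j\mid\mathcal{X}(0)=i)$ and $G_{N,j|i}(w)=\Pr(W_N(\rho)\le w,\ \mathcal{X}_N(1)=j\mid\mathcal{X}_N(0)=i)$. They may have atoms; the paper writes $dG_{j|i}(w)=f_{W(\rho),S_{\mathrm f}|S_{\mathrm i}}(w,j|i)\,dw$, with $f$ a density possibly including Dirac components. *)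

(* Defs.v *)
From HB Require Import structures.
From mathcomp Require Import all_boot all_order all_algebra.
From mathcomp Require Import all_classical all_reals all_analysis.

Set Implicit Arguments.
Unset Strict Implicit.
Unset Printing Implicit Defensive.

Import Order.TTheory GRing.Theory Num.Theory.
Import numFieldNormedType.Exports.

Local Open Scope classical_set_scope.
Local Open Scope ring_scope.

(* A chain with S states labelled 1, ..., S is indexed by 'I_n.+1 with S = n.+1:
   label k is the ordinal k - 1, so label 1 is ord0 and label S is ord_max. *)

Definition cprob (R : realType) (d : measure_display) (T : measurableType d)
    (P : probability T R) (A B : set T) : R :=
  fine (P (A `&` B)) / fine (P B).

Definition expm (R : realType) (n : nat) (A : 'M[R]_n) : 'M[R]_n :=
  \matrix_(i, j) limn (series (fun k : nat => (A ^+ k) i j / k`!%:R)).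

Definition is_generator (R : realType) (n : nat) (Q : 'M[R]_n) : Prop :=
  (forall k l, k != l -> 0 <= Q k l) /\ (forall k, \sum_l Q k l = 0).

(* Only the values X t with 0 <= t matter.  The last clause is the Markov
   property, with homogeneous transition function t |-> expm (t *: Q). *)
Definition is_ctmc (R : realType) (d : measure_display) (T : measurableType d)
    (P : probability T R) (n : nat) (Q : 'M[R]_n) (X : R -> T -> 'I_n) : Prop :=
  [/\ is_generator Q,
      (forall t k, 0 <= t -> measurable [set w | X t w = k]),
      (forall w t, 0 <= t -> \forall s \near t^'+, X s w = X t w) &
      (forall (m : nat) (t : nat -> R) (x : nat -> 'I_n),
          0 <= t 0%N -> {homo t : k l / (k < l)%N >-> k < l} ->
          P [set w | forall k, (k <= m.+1)%N -> X (t k) w = x k] =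
          (P [set w | forall k, (k <= m)%N -> X (t k) w = x k] *
           (expm ((t m.+1 - t m) *: Q) (x m) (x m.+1))%:E)%E)].

Definition sampled (R : realType) (T : Type) (n : nat) (X : R -> T -> 'I_n)
    (N : nat) : R -> T -> 'I_n :=
  fun t => X ((Num.floor (N%:R * t))%:~R / N%:R).

Definition occupation (R : realType) (T : Type) (n : nat) (Z : R -> T -> 'I_n)
    (k : 'I_n) (w : T) : R :=
  \int[@lebesgue_measure R]_(t in `[0, 1]) (Z t w == k)%:R.

Definition weighted_sum (R : realType) (T : Type) (n : nat)
    (Z : R -> T -> 'I_n) (b : 'I_n -> R) (w : T) : R :=
  \sum_k occupation Z k w * b k.

Definition bcoef (R : realType) (n : nat) (eps : 'I_n -> R) (rho : R)
    (k : 'I_n) : R :=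
  - ln (2 `^ (- rho) *
        (eps k `^ (1 + rho)^-1 + (1 - eps k) `^ (1 + rho)^-1) `^ (1 + rho)).

(* G is determined by this property: it is finite, hence characterized by its
   distribution function. *)
Definition has_joint_df (R : realType) (d : measure_display)
    (T : measurableType d) (P : probability T R) (n : nat)
    (Z : R -> T -> 'I_n) (b : 'I_n -> R) (i j : 'I_n)
    (G : {measure set (measurableTypeR R) -> \bar R}) : Prop :=
  forall x : R, G `]-oo, x]%classic =
    (cprob P [set w | weighted_sum Z b w <= x /\ Z 1 w = j]
             [set w | Z 0 w = i])%:E.

(* S_0, ..., S_N with S_n = X (n / N). *)
Definition channel_states (R : realType) (T : Type) (n : nat)
    (X : R -> T -> 'I_n) (N : nat) (w : T) : {ffun 'I_N.+1 -> 'I_n} :=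
  [ffun k : 'I_N.+1 => X ((k : nat)%:R / N%:R) w].

Definition word (N : nat) := {ffun 'I_N -> bool}.
Definition codebook (M N : nat) := {ffun 'I_M -> word N}.

Definition flip_prob (R : realType) (e : R) (x y : bool) : R :=
  if y != x then e else 1 - e.

(* The 0-based position k : 'I_N stands for time k + 1, which uses S_k. *)
Definition likelihood (R : realType) (n N : nat) (eps : 'I_n -> R)
    (s : {ffun 'I_N.+1 -> 'I_n}) (x y : word N) : R :=
  \prod_(k < N) flip_prob (eps (s (widen_ord (leqnSn N) k))) (x k) (y k).

Definition discrete_rv (d : measure_display) (T : measurableType d)
    (F : finType) (f : T -> F) : Prop :=
  forall v : F, measurable [set w | f w = v].

(* msg has an arbitrary law; St are the states, cb is the codebook and Y the
   output.  Independent uniform code bits amount to a uniform codebook among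
   the 2 ^ (M N) possible ones. *)
Definition random_coding (R : realType) (d : measure_display)
    (T : measurableType d) (P : probability T R) (n N M : nat)
    (eps : 'I_n -> R) (St : T -> {ffun 'I_N.+1 -> 'I_n})
    (msg : T -> 'I_M) (cb : T -> codebook M N) (Y : T -> word N) : Prop :=
  [/\ [/\ discrete_rv msg, discrete_rv cb & discrete_rv Y],
      (forall c, P [set w | cb w = c] = (2^-1 ^+ (M * N))%:E),
      (forall m c s,
          P [set w | [/\ msg w = m, cb w = c & St w = s]] =
          (P [set w | msg w = m] * P [set w | cb w = c] *
           P [set w | St w = s])%E) &
      (forall m c s y,
          P [set w | [/\ msg w = m, cb w = c, St w = s & Y w = y]] =
          (P [set w | [/\ msg w = m, cb w = c & St w = s]] *
           (likelihood eps s (c m) y)%:E)%E)].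

(* Ties may be broken in any way. *)
Definition is_ml_decoder (R : realType) (n N M : nat) (eps : 'I_n -> R)
    (dec : codebook M N -> {ffun 'I_N.+1 -> 'I_n} -> word N -> 'I_M) : Prop :=
  forall (c : codebook M N) (s : {ffun 'I_N.+1 -> 'I_n}) (y : word N)
    (m : 'I_M),
    likelihood eps s (c m) y <= likelihood eps s (c (dec c s y)) y.

Definition failure_prob (R : realType) (d : measure_display)
    (T : measurableType d) (P : probability T R) (n N M : nat)
    (St : T -> {ffun 'I_N.+1 -> 'I_n})
    (msg : T -> 'I_M) (cb : T -> codebook M N) (Y : T -> word N)
    (dec : codebook M N -> {ffun 'I_N.+1 -> 'I_n} -> word N -> 'I_M)
    (i j : 'I_n) : R :=
  cprob P [set w | dec (cb w) (St w) (Y w) != msg w /\ St w ord_max = j]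
          [set w | St w ord0 = i].

Definition gN (R : realType) (rho rate : R) (N : nat) (x : R) : R :=
  Num.min 1 (expR (- (N%:R * (x - rho * rate)))).

Definition glim (R : realType) (rho rate : R) (x : R) : R :=
  \1_(`]-oo, rho * rate]) x.

(* Main.v *)
(* Coding bound: conditionally on the states this is Gallager's random coding
   argument with exponent rho.  A failure forces the sum over the wrong words of
   (likelihood)^(1/(1+rho)) to reach that of the sent word; pairwise independence
   of the code words and concavity of z^rho give M^rho times a product over the
   time slots, whose factors are exp (- b_k (rho)).  Since N W_N is the sum of the
   b's along the states, the bound is exactly g_N (W_N).

   Limits: each path is constant near all but countably many times, so W_N tends
   to W everywhere, and bounded convergence applies as soon as g_N (W_N) tends to
   g (W) almost surely.  Only the event W = rho R is delicate.  If the path is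
   constant on [0, 1[ there, then W_N = W.  Otherwise the first jump, from k to l
   say, occurs at some time tau, and the path stays at l up to a fixed rational
   time r.  Given X_r = l the part of W after r is independent of tau, and for
   each of its values the equation W = rho R confines tau to a bounded number of
   cells of any given mesh h, while a jump from k to l in a given cell has a
   probability that vanishes with h.  Hence this event is negligible. *)
Require Import Defs.
From HB Require Import structures.
From mathcomp Require Import all_boot all_order all_algebra.
From mathcomp Require Import all_classical all_reals all_analysis.
From mathcomp Require Import measurable_realfun.
From mathcomp Require Import ring lra zify.

Import Order.TTheory GRing.Theory Num.Theory.
Import numFieldNormedType.Exports.

Local Open Scope classical_set_scope.
Local Open Scope ring_scope.

(** * Monotonicity of the exponents *)

(** Scaling reduces to [y = 1]. With a positive argument written exp x, the claim is [a] times
    exp(ax)(1 + (1-a)x) <= exp x plus [1 - a] times exp(ax)(1 - ax) < 1, and both of these come from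
    the tangent of exp at 0. *)
Lemma powR_lt_tangent {R : realType} {a y z : R} : 0 < a < 1 -> 0 < y -> 0 <= z ->
  z != y -> z `^ a < y `^ a * (1 + a * (z / y - 1)).
Proof.
move=> /andP[a0 a1] y0 z0 zy.
have -> : z `^ a = y `^ a * (z / y) `^ a.
  rewrite -powRM ?divr_ge0 ?(ltW y0)//.
  by rewrite [y * _]mulrC divfK ?gt_eqF.
rewrite ltr_pM2l ?powR_gt0//.
have : z / y != 1.
  by apply: contra zy => /eqP e; rewrite -[z](divfK (lt0r_neq0 y0)) e mul1r.
have : 0 <= z / y by rewrite divr_ge0// ltW.
move: (z / y) => {z zy z0} t t0 t1.
move: t0; rewrite le_eqVlt => /predU1P[<-|t0].
  by rewrite powR0 ?gt_eqF//; lra.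
have x0 : ln t != 0 by rewrite ln_eq0.
rewrite /powR gt_eqF// -[in ltRHS](lnK t0).
move: (ln t) x0 => x x0.
have -> : expR x = expR (a * x) * expR (x - a * x) by rewrite -expRD addrC subrK.
have E0 := expR_gt0 (a * x).
have H1 : expR (a * x) * (1 + (x - a * x)) <= expR (a * x) * expR (x - a * x).
  by rewrite ler_pM2l// expR_ge1Dx.
have H2 : expR (a * x) * (1 - a * x) < 1.
  have h : - (a * x) != 0 by rewrite oppr_eq0 mulf_neq0// gt_eqF.
  have : 1 - a * x < (expR (a * x))^-1 by rewrite -expRN expR_gt1Dx.
  by rewrite -(ltr_pM2l E0) mulfV// gt_eqF.
nra.
Qed.

Lemma powR_le_tangent {R : realType} {a y z : R} : 0 < a < 1 -> 0 < y -> 0 <= z ->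
  z `^ a <= y `^ a * (1 + a * (z / y - 1)).
Proof.
move=> a01 y0 z0; have [->|zy] := eqVneq z y; last exact/ltW/powR_lt_tangent.
by rewrite divff ?gt_eqF// subrr mulr0 addr0 mulr1.
Qed.

(** Adding the tangent bounds at [y] and [1 - y] leaves a difference of slopes, whose sign is known
    since [y <= 1 - y]. This is what orders the exponents of the states. *)
Lemma powR_symm_lt (R : realType) (a x y : R) : 0 < a < 1 -> 0 <= x -> x < y ->
  y <= 2^-1 -> x `^ a + (1 - x) `^ a < y `^ a + (1 - y) `^ a.
Proof.
move=> a01 x0 xy y12; have /andP[a0 a1] := a01.
have y0 : 0 < y by exact: le_lt_trans xy.
have Y0 : 0 < 1 - y by lra.
have H1 := @powR_lt_tangent R a y x a01 y0 x0 ltac:(by rewrite lt_eqF).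
have H2 := @powR_le_tangent R a (1 - y) (1 - x) a01 Y0 ltac:(lra).
apply: lt_le_trans (ltr_leD H1 H2) _.
have -> : x / y - 1 = - ((y - x) / y) by field; rewrite gt_eqF.
have -> : (1 - x) / (1 - y) - 1 = (y - x) / (1 - y) by field; rewrite gt_eqF.
(* Up to the factor [a], these are the slopes of z^a at [1 - y] and at [y]. *)
have K : (1 - y) `^ a / (1 - y) <= y `^ a / y.
  have -> : (1 - y) `^ a = y `^ a * ((1 - y) / y) `^ a.
    rewrite -powRM ?divr_ge0 ?(ltW y0) ?(ltW Y0)//.
    by rewrite [y * _]mulrC divfK ?gt_eqF.
  rewrite -mulrA ler_pM2l ?powR_gt0// ler_pdivrMr//.
  rewrite [leRHS]mulrC; apply: ler1_powR; last exact: ltW.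
  by rewrite ler_pdivlMr//; lra.
have : 0 < a * (y - x) by rewrite mulr_gt0// subr_gt0.
move=> /ltW /ler_wpM2l /(_ _ _ K).
lra.
Qed.

Section exponent_coefficients.
Context {R : realType} {n : nat} {eps : 'I_n.+1 -> R} {rho : R}.
Hypotheses (eps0 : forall k, 0 <= eps k)
  (eps_lt : {homo eps : k l / (k < l)%N >-> k < l})
  (eps_half : eps ord_max <= 2^-1) (rho01 : 0 < rho < 1).

Let a := (1 + rho)^-1.

Let a01 : 0 < a < 1.
Proof.
have /andP[? ?] := rho01.
by rewrite /a invr_gt0 invf_lt1; lra.
Qed.

Lemma eps_le_half k : eps k <= 2^-1.
Proof.
apply: le_trans eps_half; have [->//|kn] := eqVneq k ord_max.
apply/ltW/eps_lt; rewrite ltn_neqAle -ltnS ltn_ord andbT.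
by apply: contra kn => /eqP kn; apply/eqP/val_inj.
Qed.

Lemma chernoff_gt0 k : 0 < eps k `^ a + (1 - eps k) `^ a.
Proof.
have := eps_le_half k; have := eps0 k => ? ?.
by rewrite ltr_wpDl ?powR_ge0// powR_gt0; lra.
Qed.

Lemma expR_Nbcoef k : expR (- bcoef eps rho k) =
  2 `^ (- rho) * (eps k `^ a + (1 - eps k) `^ a) `^ (1 + rho).
Proof.
by rewrite /bcoef opprK lnK// posrE mulr_gt0 ?powR_gt0 ?chernoff_gt0.
Qed.

Lemma bcoef_lt (k l : 'I_n.+1) : (k < l)%N -> bcoef eps rho l < bcoef eps rho k.
Proof.
move=> kl; rewrite -ltrN2 -ltr_expR [ltLHS]expR_Nbcoef [ltRHS]expR_Nbcoef.
rewrite ltr_pM2l; last by rewrite powR_gt0.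
have r0 : 0 < 1 + rho by case/andP: rho01 => ? _; rewrite addr_gt0.
apply: gt0_ltr_powR; [by [] | by rewrite nnegrE; exact/ltW/chernoff_gt0 |
  by rewrite nnegrE; exact/ltW/chernoff_gt0 |].
by apply: powR_symm_lt => //; [exact: eps_lt|exact: eps_le_half].
Qed.

(** Distinct exponents make the weighted sum depend on the time of a jump; the exclusion of atoms
    rests on this. *)
Lemma bcoef_inj k l : k != l -> bcoef eps rho k != bcoef eps rho l.
Proof.
rewrite -(inj_eq val_inj) neq_ltn => /orP[] /bcoef_lt kl.
  by rewrite gt_eqF.
by rewrite lt_eqF.
Qed.

Lemma bcoef_bounds k : bcoef eps rho ord_max <= bcoef eps rho k <= bcoef eps rho ord0.
Proof.
apply/andP; split.
  have [->//|kn] := eqVneq k ord_max; apply/ltW/bcoef_lt.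
  rewrite ltn_neqAle -ltnS ltn_ord andbT.
  by apply: contra kn => /eqP kn; apply/eqP/val_inj.
have [->//|kn] := eqVneq k ord0; apply/ltW/bcoef_lt.
by rewrite lt0n; apply: contra kn => /eqP kn; apply/eqP/val_inj.
Qed.

End exponent_coefficients.

(** * The random coding bound *)

Lemma powR_prod (R : realType) (I : finType) (F : I -> R) (r : R) :
  (forall i, 0 <= F i) -> (\prod_i F i) `^ r = \prod_i F i `^ r.
Proof.
move=> F0; suff [] : (\prod_i F i) `^ r = \prod_i F i `^ r /\ 0 <= \prod_i F i by [].
elim/big_rec2 : _ => [|i x y _ [<- y0]]; first by rewrite powR1.
by rewrite powRM// mulr_ge0.
Qed.

(** * Averages over a uniform codebook *)

Section random_codebook.
Context {R : realType} (M N : nat).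

Lemma sum_codebook (F : 'I_M -> word N -> R) :
  \sum_(c : codebook M N) 2^-1 ^+ (M * N) * \prod_m F m (c m) =
  \prod_m \sum_(x : word N) 2^-1 ^+ N * F m x.
Proof.
rewrite bigA_distr_bigA; apply: eq_bigr => c _.
by rewrite big_split/= prodr_const card_ord -exprM mulnC.
Qed.

Lemma sum_word : \sum_(x : word N) 2^-1 ^+ N = 1 :> R.
Proof.
rewrite sumr_const card_ffun card_bool card_ord -[LHS]mulr_natr natrX -exprMn.
by rewrite mulVf ?expr1n ?pnatr_eq0.
Qed.

Lemma sum_codebook1 (f : word N -> R) m :
  \sum_(c : codebook M N) 2^-1 ^+ (M * N) * f (c m) =
  \sum_(x : word N) 2^-1 ^+ N * f x.
Proof.
pose F m' x := if m' == m then f x else 1.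
transitivity (\sum_(c : codebook M N) 2^-1 ^+ (M * N) * \prod_m' F m' (c m')).
  apply: eq_bigr => c _; congr (_ * _).
  rewrite (bigD1 m)//= big1 ?mulr1 /F ?eqxx// => m' /negbTE mm.
  by rewrite mm.
rewrite sum_codebook (bigD1 m)//= [X in _ * X]big1 ?mulr1.
  by under eq_bigr do rewrite /F eqxx.
move=> m' /negbTE mm; rewrite -[RHS]sum_word.
by apply: eq_bigr => x _; rewrite /F mm mulr1.
Qed.

(** Pairwise independence of the words, in the form that Gallager's argument uses; the remaining
    words contribute factors 1. *)
Lemma sum_codebook2 (f : word N -> R) m m' : m' != m ->
  \sum_(c : codebook M N) 2^-1 ^+ (M * N) * (f (c m) * f (c m')) =
  (\sum_(x : word N) 2^-1 ^+ N * f x) ^+ 2.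
Proof.
move=> mm.
pose F k x := if (k == m) || (k == m') then f x else 1.
transitivity (\sum_(c : codebook M N) 2^-1 ^+ (M * N) * \prod_k F k (c k)).
  apply: eq_bigr => c _; congr (_ * _).
  rewrite (bigD1 m)//= (bigD1 m')//= big1 ?mulr1 /F ?eqxx ?orbT//.
  by move=> k /andP[/negbTE -> /negbTE ->].
rewrite sum_codebook (bigD1 m)//= (bigD1 m')//= [X in _ * (_ * X)]big1 ?mulr1.
  under eq_bigr do rewrite /F eqxx.
  by under [X in _ * X]eq_bigr do rewrite /F eqxx orbT.
move=> k /andP[/negbTE km /negbTE km']; rewrite -[RHS]sum_word.
by apply: eq_bigr => x _; rewrite /F km km' mulr1.
Qed.

End random_codebook.

(** * Gallager's argument for a fixed state sequence *)

Section gallager_bound.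
Context {R : realType} {n N M : nat} {eps : 'I_n.+1 -> R} {rho : R}.
Hypotheses (eps0 : forall k, 0 <= eps k)
  (eps_lt : {homo eps : k l / (k < l)%N >-> k < l})
  (eps_half : eps ord_max <= 2^-1) (rho01 : 0 < rho < 1).
Variable s : {ffun 'I_N.+1 -> 'I_n.+1}.

Let e (k : 'I_N) := eps (s (widen_ord (leqnSn N) k)).
Let b (k : 'I_N) := bcoef eps rho (s (widen_ord (leqnSn N) k)).
Let a := (1 + rho)^-1.
Let f (x y : word N) := likelihood eps s x y `^ a.

Let e_half k : e k <= 2^-1. Proof. exact: eps_le_half. Qed.

Let flip_ge0 k (u v : bool) : 0 <= flip_prob (e k) u v.
Proof.
have := e_half k; have : 0 <= e k by exact: eps0.
by rewrite /flip_prob; case: ifP; lra.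
Qed.

Lemma likelihood_ge0 x y : 0 <= likelihood eps s x y.
Proof. by apply: prodr_ge0 => k _; exact: flip_ge0. Qed.

Lemma sum_likelihood x : \sum_y likelihood eps s x y = 1.
Proof.
rewrite /likelihood -(bigA_distr_bigA (fun k v => flip_prob (e k) (x k) v)).
rewrite big1// => k _; rewrite big_bool /flip_prob.
by case: (x k) => /=; rewrite ?subrK// addrC subrK.
Qed.

(** The mean of [f x y] over a uniform word [x]. By the symmetry of the binary channel it is the
    same for every output [y]. *)
Let E := \prod_(k < N) (2^-1 * (e k `^ a + (1 - e k) `^ a)).

Let h_gt0 k : 0 < e k `^ a + (1 - e k) `^ a.
Proof. exact: (chernoff_gt0 eps0 eps_lt eps_half). Qed.

Let E_gt0 : 0 < E.
Proof. by apply: prodr_gt0 => k _; rewrite mulr_gt0 ?invr_gt0. Qed.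

Let sum_f y : \sum_(x : word N) 2^-1 ^+ N * f x y = E.
Proof.
transitivity (\sum_(x : word N) \prod_(k < N) (2^-1 * flip_prob (e k) (x k) (y k) `^ a)).
  apply: eq_bigr => x _; rewrite big_split/= prodr_const card_ord.
  by rewrite /f /likelihood powR_prod// => k; exact: flip_ge0.
rewrite -(bigA_distr_bigA (fun k u => 2^-1 * flip_prob (e k) u (y k) `^ a)).
apply: eq_bigr => k _; rewrite big_bool /flip_prob.
by case: (y k) => /=; rewrite -mulrDr// addrC.
Qed.

(** The 2^N outputs give a factor 2 per time slot, and 2 (1/2)^(1 + rho) = 2^(-rho) is the constant
    in the exponents. *)
Let sum_E : \sum_(y : word N) E `^ (1 + rho) = expR (- \sum_(k < N) b k).
Proof.
rewrite sumr_const card_ffun card_bool card_ord /E powR_prod; last first.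
  by move=> k; rewrite mulr_ge0 ?invr_ge0//; exact/ltW/h_gt0.
rewrite -sumrN expR_sum.
transitivity (\prod_(k < N) (2 * (2^-1 * (e k `^ a + (1 - e k) `^ a)) `^ (1 + rho))).
  by rewrite big_split/= prodr_const card_ord -natrX mulr_natl.
apply: eq_bigr => k _; rewrite expR_Nbcoef//.
rewrite powRM ?invr_ge0//; last exact: ltW.
rewrite mulrA; congr (_ * _).
rewrite -powR_inv1// -powRrM mulN1r opprD -{1}(@powRr1 _ 2)//.
by rewrite -powRD ?addrNK// ?pnatr_eq0 ?implybT// addrA subrr add0r.
Qed.

Variables (dec : word N -> codebook M N -> 'I_M) (m : 'I_M).
Hypothesis M1 : (1 < M)%N.
Hypothesis dec_ml : forall (c : codebook M N) y k,
  likelihood eps s (c k) y <= likelihood eps s (c (dec y c)) y.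

Let Z (c : codebook M N) y := \sum_(k | k != m) f (c k) y.

Let f_ge0 x y : 0 <= f x y. Proof. exact: powR_ge0. Qed.

Let Z_ge0 c y : 0 <= Z c y. Proof. exact: sumr_ge0. Qed.

Let aD : a + a * rho = 1.
Proof.
have /andP[? ?] := rho01.
by rewrite -{1}[a]mulr1 -mulrDr /a mulVf// gt_eqF// addr_gt0.
Qed.

(** By [aD] a likelihood p equals p^a (p^a)^rho. When decoding fails, the decoded word is one of the
    terms of [Z] and its likelihood is at least p, so [Z] is at least p^a. *)
Let likelihood_failure (c : codebook M N) y :
  likelihood eps s (c m) y * (dec y c != m)%:R <= f (c m) y * Z c y `^ rho.
Proof.
have /andP[r0 r1] := rho01.
have a0 : 0 < a by rewrite invr_gt0 addr_gt0.
case: (eqVneq (dec y c) m) => [_|dm].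
  by rewrite mulr0 mulr_ge0// powR_ge0.
rewrite mulr1 -[leLHS]powRr1 ?likelihood_ge0// -aD.
rewrite powRD; last by rewrite aD oner_eq0.
apply: ler_wpM2l; first exact: powR_ge0.
rewrite powRrM; apply: ge0_ler_powR; rewrite ?nnegrE ?powR_ge0 ?(ltW r0)//.
rewrite /Z (bigD1 (dec y c))//=.
rewrite ler_wpDr ?sumr_ge0//; apply: ge0_ler_powR; rewrite ?dec_ml ?nnegrE ?likelihood_ge0 ?(ltW a0)//.
Qed.

(** Pairwise independence makes the mean of [Z] weighted by [f (c m) y] equal to [A * E], where [E]
    is the total weight. So the linear term of the tangent at [A] averages to zero and [A ^ rho * E]
    remains. *)
Let sum_failure y :
  \sum_(c : codebook M N) 2^-1 ^+ (M * N) * (f (c m) y * Z c y `^ rho) <=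
  M.-1%:R `^ rho * E `^ (1 + rho).
Proof.
have /andP[r0 r1] := rho01.
have M0 : 0 < M.-1%:R :> R by rewrite ltr0n; case: M M1 => [|[]].
pose A := M.-1%:R * E.
have A0 : 0 < A by rewrite mulr_gt0.
have -> : M.-1%:R `^ rho * E `^ (1 + rho) = A `^ rho * E.
  rewrite /A powRM ?ltW// -mulrA; congr (_ * _).
  rewrite powRD; last by rewrite (gt_eqF E_gt0) implybT.
  by rewrite powRr1 ?ltW// mulrC.
apply: (@le_trans _ _ (\sum_(c : codebook M N) A `^ rho *
   ((1 - rho) * (2^-1 ^+ (M * N) * f (c m) y) +
    rho / A * \sum_(k | k != m) 2^-1 ^+ (M * N) * (f (c m) y * f (c k) y)))).
  apply: ler_sum => c _.
  (* Jensen's inequality for [z `^ rho] through its tangent at the mean [A] of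
     [Z c y] under the weights [f (c m) y] *)
  have H := powR_le_tangent rho01 A0 (Z_ge0 c y).
  have W : 0 <= 2^-1 ^+ (M * N) * f (c m) y by rewrite mulr_ge0// exprn_ge0// invr_ge0.
  apply: (@le_trans _ _ (2^-1 ^+ (M * N) * f (c m) y * (A `^ rho * (1 + rho * (Z c y / A - 1))))).
    by rewrite mulrA ler_wpM2l.
  under eq_bigr do rewrite mulrA.
  rewrite -mulr_sumr -/(Z c y).
  move: (f (c m) y) (Z c y) (A `^ rho) (2^-1 ^+ (M * N)) => u v w x.
  by rewrite le_eqVlt; apply/orP; left; apply/eqP; field; exact: lt0r_neq0.
rewrite -mulr_sumr ler_wpM2l ?powR_ge0//.
have /= S1 := sum_codebook1 M N (f ^~ y) m.
have /= S2 := sum_codebook2 M N (f ^~ y) m.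
rewrite big_split/= -[\sum_c (1 - rho) * _]mulr_sumr -[\sum_c rho / A * _]mulr_sumr.
rewrite S1 sum_f exchange_big/=.
under eq_bigr => k km do rewrite S2// sum_f.
rewrite sumr_const.
have -> : #|(fun k => k != m)| = M.-1.
  by rewrite -[in RHS](card_ord M) -(cardC1 m); apply: eq_card.
rewrite -mulr_natl.
have -> : rho / A * (M.-1%:R * E ^+ 2) = rho * E.
  by rewrite /A; field; rewrite !gt_eqF.
lra.
Qed.

(** The left side is the failure probability given message [m] and states [s]. The bound 1 holds
    because it averages probabilities; the other sums [sum_failure] over the outputs. *)
Lemma gallager_bound :
  \sum_(c : codebook M N) \sum_(y : word N)
     2^-1 ^+ (M * N) * (likelihood eps s (c m) y * (dec y c != m)%:R) <=
  Num.min 1 (M%:R `^ rho * expR (- \sum_(k < N) b k)).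
Proof.
have /andP[r0 r1] := rho01.
rewrite le_min; apply/andP; split.
  rewrite [leRHS](_ : _ = \sum_(c : codebook M N) 2^-1 ^+ (M * N) * 1); last first.
    by have /= -> := sum_codebook1 M N (fun=> 1) m; under eq_bigr do rewrite mulr1; rewrite sum_word.
  apply: ler_sum => c _; rewrite -mulr_sumr ler_wpM2l ?exprn_ge0 ?invr_ge0//.
  rewrite -[leRHS](sum_likelihood (c m)); apply: ler_sum => y _.
  apply: ler_piMr; first exact: likelihood_ge0.
  by case: (dec y c != m).
rewrite exchange_big/= -sum_E mulr_sumr; apply: ler_sum => y _.
apply: le_trans (_ : M.-1%:R `^ rho * E `^ (1 + rho) <= _).
  apply: le_trans (sum_failure y); apply: ler_sum => c _.
  by rewrite ler_wpM2l ?exprn_ge0 ?invr_ge0//; exact: likelihood_failure.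
rewrite ler_wpM2r ?powR_ge0// ge0_ler_powR ?nnegrE ?(ltW r0)//.
by rewrite ler_nat leq_pred.
Qed.

End gallager_bound.

(** * Integrals against a joint distribution function *)

(** The half-lines form a pi-system of sets of finite measure that generates the Borel sets and
    exhausts the line. *)
Lemma measure_df_unique {R : realType}
    (m1 m2 : {measure set (measurableTypeR R) -> \bar R}) :
  (forall x, m1 `]-oo, x] = m2 `]-oo, x])%classic ->
  (forall x, m1 `]-oo, x]%classic < +oo)%E ->
  forall A, measurable A -> m1 A = m2 A.
Proof.
move=> m12 m1oo A mA.
pose H : set (set (measurableTypeR R)) := [set B | exists x : R, B = `]-oo, x]%classic].
apply: (@measure_unique _ _ _ H (fun k => `]-oo, k%:R]%classic)) => //.
- apply/seteqP; split; last first.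
    apply: smallest_sub; first exact: smallest_sigma_algebra.
    by move=> _ [x ->]; exact: measurable_itv.
  apply: smallest_sub; first exact: smallest_sigma_algebra.
  move=> _ [[a b] _ <-].
  (* The intervals that define the Borel sets are differences of half-lines. *)
  have -> : `]a, b]%classic = `]-oo, b] `\` `]-oo, a] :> set (measurableTypeR R).
    apply/seteqP; split=> x /=; rewrite !in_itv/=.
      by move=> /andP[ax ->]; split=> //; apply/negP; rewrite -ltNge.
    by move=> [-> /negP]; rewrite -ltNge => ->.
  have HI x : <<s H >> `]-oo, x]%classic by apply: sub_sigma_algebra; exists x.
  by apply: (@measurableD _ (g_sigma_algebraType H)); exact: HI.
- move=> _ _ [x ->] [y ->]; exists (Num.min x y).
  by apply/seteqP; split=> z /=; rewrite !in_itv/= le_min => /andP.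
- by move=> k; exists k%:R.
- apply/seteqP; split=> // x _; exists (Num.bound `|x|) => //=.
  rewrite in_itv/=; apply/ltW/(le_lt_trans (ler_norm x)).
  by rewrite archi_boundP.
- by move=> _ [x ->].
Qed.

Section transfer.
Context {R : realType} {d : measure_display} {T : measurableType d}
  (P : probability T R) {V : T -> R} {A : set T}.
Hypotheses (mV : measurable_fun setT V) (mA : measurable A).
Context (k : {nonneg R}) {G : {measure set (measurableTypeR R) -> \bar R}}.
Hypothesis GE : forall x,
  G `]-oo, x]%classic = (k%:num%:E * P ([set w | V w <= x]%R `&` A))%E.

(** By uniqueness [G] is [k] times the image under [V] of [P] restricted to [A], so integrals
    against it become expectations on the sample space, where convergence can be studied path by
    path. *)
Lemma integral_df (D : set (measurableTypeR R)) (f : measurableTypeR R -> \bar R) :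
  measurable D -> measurable_fun setT f -> (forall x, 0 <= f x)%E ->
  (forall w, D (V w)) ->
  (\int[G]_(x in D) f x = k%:num%:E * \int[P]_(w in A) f (V w))%E.
Proof.
move=> mD mf f0 DV.
have mfV : measurable_fun setT (f \o V) by exact: measurableT_comp.
pose mu := [the measure _ _ of pushforward (mrestr P mA) (V : T -> measurableTypeR R)].
pose nu := [the measure _ _ of mscale k (mu mV)].
rewrite (eq_measure_integral nu); last first.
  move=> B mB _; apply: measure_df_unique => //.
  move=> x; rewrite GE; apply: lte_mul_pinfty => //.
  by apply: le_lt_trans (probability_le1 _ _) _; rewrite ?ltry//; apply: measurableI => //;
    rewrite -[X in measurable X]setTI; apply: measurable_fun_le.
rewrite ge0_integral_mscale//; last exact: measurable_funTS.
congr (_ * _)%E.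
rewrite (@ge0_integral_pushforward _ _ _ (measurableTypeR R))//; last exact: measurable_funTS.
have -> : V @^-1` D = setT by apply/seteqP; split=> // w _; exact: DV.
have I0 B : measurable B -> (\int[mrestr P mA]_(x in B) f (V x) =
    \int[mrestr P mA]_(x in B `&` A) f (V x))%E.
  move=> mB; rewrite (@ge0_negligible_integral _ _ _ _ B (~` A))//.
  - by rewrite setDE setCK.
  - exact: measurableC.
  - exact: measurable_funTS.
  - by rewrite /= /mrestr setICl measure0.
rewrite I0// setTI; apply: eq_measure_integral => B mB BA.
by rewrite /= /mrestr setIidl.
Qed.

End transfer.

(** * Right-continuous paths and occupation times *)

Section right_constant_path.
Context {R : realType} {E : Type} {x : R -> E}.
Hypothesis x_right : forall t, 0 <= t -> \forall s \near t^'+, x s = x t.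

Lemma right_constantP t : 0 <= t ->
  exists2 e, 0 < e & forall s, t <= s < t + e -> x s = x t.
Proof.
move=> /x_right /nbhs_ballP[e /= e0 He]; exists e => // s /andP[].
rewrite le_eqVlt => /predU1P[->//|ts se]; apply: He => //.
by rewrite /ball/= distrC gtr0_norm ?subr_gt0// ltrBlDl.
Qed.

Definition loc_constant : set R := [set t | \forall s \near t, x s = x t].

Lemma open_loc_constant (B : set E) : open (loc_constant `&` x @^-1` B).
Proof.
rewrite openE => t [/= tL tB]; rewrite /interior.
apply: filterS2 (near_join tL) tL => s sL sE; split; last by rewrite /= sE.
by apply: filterS sL => u ->; rewrite sE.
Qed.

(* Distinct points of the complement start disjoint intervals of constancy. *)
Lemma countable_not_loc_constant : countable (`[0, +oo[ `\` loc_constant).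
Proof.
have /choice[e He] : forall t, exists e, 0 <= t -> 0 < e /\ forall s, t <= s < t + e -> x s = x t.
  move=> t; have [t0|] := leP 0 t; last by exists 1.
  by have [e e0 He] := right_constantP t t0; exists e.
have /choice[q Hq] : forall t, exists q : rat, 0 <= t -> t < ratr q < t + e t.
  move=> t; have [t0|] := leP 0 t; last by exists 0.
  have [e0 _] := He _ t0.
  have [q] : exists q, ratr q \in `]t, t + e t[ by apply: rat_in_itvoo; rewrite ltrDl.
  by rewrite in_itv/= => tq; exists q.
apply/countable_injP; exists (pickle \o q) => t u.
rewrite !inE/= !in_itv/= !andbT => -[t0 tL] [u0 uL] /(pcan_inj pickleK) qtu.
have H a b : 0 <= a -> ~ loc_constant b -> a < b -> q a = q b -> 0 <= b -> False.
  move=> a0 bL ab qab b0; apply: bL.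
  have [ea Ha] := He _ a0.
  have /andP[aq qa] := Hq _ a0; have /andP[bq _] := Hq _ b0.
  have be : b < a + e a by rewrite (lt_trans bq)// -qab.
  have xb : x b = x a by apply: Ha; rewrite ltW.
  have : b \in `]a, a + e a[ by rewrite in_itv/= ab.
  move=> /near_in_itvoo; apply: filterS => s; rewrite in_itv/= xb => /andP[/ltW as_ sa].
  by apply: Ha; rewrite as_.
have [tu|tu|//] := ltgtP t u.
  exfalso; exact: (H t u t0 uL tu qtu u0).
exfalso; exact: (H u t u0 tL tu (esym qtu) t0).
Qed.

(** The points of local constancy contribute an open set, the others a countable one. *)
Lemma measurable_path (B : set E) : measurable (`[0, 1] `&` x @^-1` B).
Proof.
have -> : `[0, 1] `&` x @^-1` B = (`[0, 1] `&` (loc_constant `&` x @^-1` B)) `|`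
    (`[0, 1] `&` x @^-1` B `\` loc_constant).
  apply/seteqP; split=> [t [t01 tB]|t [[t01 []//]|[]//]].
  by have [tL|tL] := pselect (loc_constant t); [left|right].
apply: measurableU.
  apply: measurableI; first exact: measurable_itv.
  by apply: open_measurable; exact: open_loc_constant.
apply: countable_measurable; first by move=> t; exact: measurable_set1.
apply: sub_countable countable_not_loc_constant; apply: subset_card_le.
by move=> t [[]] /=; rewrite !in_itv/= => /andP[-> _].
Qed.

(** The sampling time lies within 1/N of [t], hence eventually in the neighbourhood where the path
    is constant. *)
Lemma loc_constant_sampled t : loc_constant t ->
  \forall N \near \oo, x ((Num.floor (N%:R * t))%:~R / N%:R) = x t.
Proof.
move=> /nbhs_ballP[e /= e0 He].
near=> N; apply: He; rewrite /ball/=.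
have N0 : 0 < N%:R :> R by rewrite ltr0n; near: N; exact: nbhs_infty_gt.
have eN : e^-1 < N%:R :> R by near: N; exact: nbhs_infty_gtr.
have /andP[f1 f2] := floor_itv (N%:R * t).
rewrite ger0_norm; last by rewrite subr_ge0 ler_pdivrMr// [leRHS]mulrC.
rewrite -(ltr_pM2r N0) mulrBl divfK ?gt_eqF//; apply: (@le_lt_trans _ _ 1).
  by move: f2; rewrite intrD => f2; lra.
by rewrite -ltr_pdivrMl// mulr1.
Unshelve. all: by end_near.
Qed.

End right_constant_path.

(** * Occupation times of the sampled path and their limit *)

Section occupation_times.
Context {R : realType} {T : Type} {n : nat} {X : R -> T -> 'I_n}.
Local Notation mu := (@lebesgue_measure R).

Let cell N q : set R := `[q%:R / N%:R, q.+1%:R / N%:R[%classic.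

(** There are [N.+1] cells because the right endpoint [t = 1] falls in the cell of index [N]. *)
Lemma sampled_cells N w k t : (0 < N)%N -> t \in `[0, 1] ->
  (sampled X N t w == k)%:R =
  \sum_(q < N.+1) (X (q%:R / N%:R) w == k)%:R * \1_(cell N q) t :> R.
Proof.
move=> N0; rewrite in_itv/= => /andP[t0 t1].
have N0' : 0 < N%:R :> R by rewrite ltr0n.
have Nt0 : 0 <= N%:R * t by rewrite mulr_ge0// ltW.
have qN : (Num.truncn (N%:R * t) < N.+1)%N.
  rewrite truncn_lt_nat// (@le_lt_trans _ _ N%:R) ?ltr_nat//.
  by rewrite ger_pMr.
have cellE q : cell N q t = (Num.truncn (N%:R * t) == q).
  rewrite truncn_eq// /cell /= in_itv/=.
  by rewrite ler_pdivrMr// ltr_pdivlMr// [t * _]mulrC.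
rewrite (bigD1 (Ordinal qN))//= big1 ?addr0 => [|q qt].
  rewrite indicE mem_set ?mulr1; last by rewrite cellE.
  rewrite /sampled; congr ((X (_ / _) w == k)%:R).
  by rewrite /= truncn_floor Nt0 natr_absz ger0_norm// floor_ge0.
rewrite indicE memNset ?mulr0// cellE => /eqP e.
by move/eqP: qt; apply; apply/val_inj.
Qed.

Let cell_measure N q : (0 < N)%N -> (q < N)%N ->
  mu (cell N q `&` `[0, 1]) = (N%:R^-1)%:E.
Proof.
move=> N0 qN; have N0' : 0 < N%:R :> R by rewrite ltr0n.
rewrite setIidl; last first.
  move=> t; rewrite /cell /= !in_itv/= => /andP[qt tq].
  rewrite (le_trans _ qt) ?divr_ge0//= (le_trans (ltW tq))//.
  by rewrite ler_pdivrMr// mul1r ler_nat.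
rewrite /cell lebesgue_measure_itv/= lte_fin ltr_pM2r ?invr_gt0// ltr_nat leqnn.
by rewrite -EFinB -mulrBl -natrB// subSnn mul1r.
Qed.

Let cell_measure_last N : (0 < N)%N -> mu (cell N N `&` `[0, 1]) = 0%E.
Proof.
move=> N0; have N0' : 0 < N%:R :> R by rewrite ltr0n.
rewrite (_ : _ `&` _ = [set 1]) ?lebesgue_measure_set1//.
apply/seteqP; split=> t; rewrite /cell /= !in_itv/= divff ?gt_eqF//.
  by move=> [/andP[t1 _] /andP[_ t1']]; apply/le_anti; rewrite t1 t1'.
by move=> ->; rewrite lexx ler01 ltr_pdivlMr// mul1r ltr_nat ltnS leqnn.
Qed.

Let measurable_cell N q : measurable (cell N q).
Proof. exact: measurable_itv. Qed.

Lemma measurable_sampled N w k : (0 < N)%N ->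
  measurable_fun (`[0, 1] : set R) (fun t => (sampled X N t w == k)%:R : R).
Proof.
move=> N0.
pose f (t : R) : R := \sum_(q < N.+1) (X (q%:R / N%:R) w == k)%:R * \1_(cell N q) t.
apply: (eq_measurable_fun f) => [t /[!inE] t01|]; first by rewrite sampled_cells.
by apply: measurable_sum => q; exact: measurable_funM.
Qed.

Lemma occupation_sampled N w k : (0 < N)%N ->
  occupation (sampled X N) k w = N%:R^-1 * \sum_(q < N) (X (q%:R / N%:R) w == k)%:R.
Proof.
move=> N0; rewrite /occupation /Rintegral.
under eq_integral => t /[!inE] t01.
  rewrite sampled_cells// -sumEFin.
  under eq_bigr do rewrite EFinM.
  over.
rewrite ge0_integral_sum//=; last first.
  move=> q; apply: emeasurable_funM => //; apply/measurable_EFinP.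
  apply: measurable_indic; exact: measurable_cell.
transitivity (fine (\sum_(q < N.+1)
    ((X (q%:R / N%:R) w == k)%:R)%:E * mu (cell N q `&` `[0%R, 1%R]))%E).
  congr fine; apply: eq_bigr => q _.
  rewrite ge0_integralZl//=; last first.
    by apply/measurable_EFinP; apply: measurable_indic; exact: measurable_cell.
  by rewrite integral_indic//; exact: measurable_cell.
(* The last cell meets the unit interval in the single point 1, hence has weight 0. *)
pose c (q : 'I_N.+1) : R := if q == ord_max then 0 else N%:R^-1.
transitivity (fine (\sum_(q < N.+1) ((X (q%:R / N%:R) w == k)%:R * c q)%:E)%E).
  congr fine; apply: eq_bigr => q _; rewrite EFinM /c; congr (_ * _)%E.
  have [->|qN] := eqVneq q ord_max; first exact: cell_measure_last.
  apply: cell_measure => //; rewrite ltn_neqAle -ltnS ltn_ord andbT.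
  by apply: contra qN => /eqP qN; apply/eqP/val_inj.
rewrite sumEFin/= big_ord_recr/= /c eqxx mulr0 addr0 mulr_sumr.
apply: eq_bigr => q _; rewrite mulrC ifF//; apply/negbTE.
by rewrite -(inj_eq val_inj)/= ltn_eqF.
Qed.

Lemma weighted_sum_sampled N (b : 'I_n -> R) w : (0 < N)%N ->
  weighted_sum (sampled X N) b w = N%:R^-1 * \sum_(q < N) b (X (q%:R / N%:R) w).
Proof.
move=> N0; rewrite /weighted_sum.
under eq_bigr do rewrite occupation_sampled// -mulrA mulr_suml.
rewrite -mulr_sumr exchange_big/=; congr (_ * _); apply: eq_bigr => q _.
rewrite (bigD1 (X (q%:R / N%:R) w))//= eqxx mul1r big1 ?addr0// => k.
by rewrite eq_sym => /negbTE ->; rewrite mul0r.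
Qed.

Hypothesis X_right : forall w (t : R), 0 <= t -> \forall s \near t^'+, X s w = X t w.

(** Dominated convergence on the unit interval: the sampled indicators converge at every point of
    local constancy, and the other points are countable, hence null. *)
Lemma occupation_cvg w k :
  occupation (sampled X N) k w @[N --> \oo] --> occupation X k w.
Proof.
have X_right_w t : 0 <= t -> \forall s \near t^'+, X s w = X t w by exact: X_right.
have cst1 : mu.-integrable (`[0, 1] : set R) (cst 1%E).
  apply: (@measurable_bounded_integrable _ _ _ mu (cst 1)).
  - exact: measurable_itv.
  - by rewrite /= lebesgue_measure_itv/= lte_fin ltr01 -EFinB ltry.
  - exact: measurable_cst.
  - exact: bounded_cst.
have mX : measurable_fun (`[0, 1] : set R) (fun t => ((X t w == k)%:R)%:E : \bar R).
  apply/measurable_EFinP.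
  pose f : R -> R := \1_(`[0, 1] `&` (fun t => X t w) @^-1` [set k]).
  apply: (eq_measurable_fun f) => [t|].
    rewrite inE => t01; rewrite /f indicE; congr ((nat_of_bool _)%:R).
    by apply/idP/eqP => [/set_mem[]//|tk]; apply/mem_set.
  by apply: measurable_indic; exact: measurable_path.
have K N : measurable_fun (`[0, 1] : set R)
    (fun t => ((sampled X N.+1 t w == k)%:R)%:E : \bar R).
  by apply/measurable_EFinP; exact: measurable_sampled.
(* The shift discards [N = 0], where the sampling formula divides by zero. *)
rewrite -cvg_shiftS /occupation /Rintegral; apply: fine_cvg.
have le1 (b : bool) : (`|(b%:R)%:E| <= 1 :> \bar R)%E.
  by rewrite abse_EFin lee_fin; case: b; rewrite ?normr1 ?normr0.
have ae : {ae mu, forall t, (`[0, 1]%classic : set R) t ->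
    ((sampled X N.+1 t w == k)%:R)%:E @[N --> \oo] --> (((X t w == k)%:R)%:E : \bar R)}.
  exists (`[0, +oo[ `\` loc_constant (x := X ^~ w)); split.
  - by apply: countable_measurable; [exact: measurable_set1|exact: countable_not_loc_constant].
  - by apply: countable_lebesgue_measure0; exact: countable_not_loc_constant.
  move=> t /= tN; apply: contrapT => /= tJ; apply: tN => t01.
  have tL : loc_constant (x := X ^~ w) t.
    apply: contrapT => tL; apply: tJ; split=> //=.
    by move: t01; rewrite /= !in_itv/= => /andP[-> _].
  have : ((sampled X N t w == k)%:R)%:E @[N --> \oo] --> (((X t w == k)%:R)%:E : \bar R).
    apply: cvg_near_cst; apply: filterS (loc_constant_sampled t tL) => N.
    by rewrite /sampled => ->.
  by rewrite -cvg_shiftS.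
have [Ioo _ cv] := @dominated_convergence _ _ _ mu _ (measurable_itv _) _ _ _ K mX ae
  cst1 (aeW mu (fun _ _ _ => le1 _)).
by rewrite fineK//; apply: integrable_fin_num Ioo; exact: measurable_itv.
Qed.

Lemma weighted_sum_cvg (b : 'I_n -> R) w :
  weighted_sum (sampled X N) b w @[N --> \oo] --> weighted_sum X b w.
Proof.
apply: (@cvg_big _ _ _ _ _ _ _ _ _ (fun k N => occupation (sampled X N) k w * b k)) => [|k _].
  exact: add_continuous.
by apply: cvgMr_tmp; exact: occupation_cvg.
Qed.

End occupation_times.

(** * Atoms of the weighted occupation time *)

Section finite_partition.
Context {R : realType} {d : measure_display} {T : measurableType d}
  {P : probability T R}.

Lemma probability_fine (A : set T) : measurable A -> P A = (fine (P A))%:E.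
Proof. by move=> mA; rewrite fineK// fin_num_measure. Qed.

Lemma fine_probability_ge0 (A : set T) : 0 <= fine (P A).
Proof. exact: fine_ge0. Qed.

Lemma le_fine_probability (A B : set T) : measurable A -> measurable B ->
  A `<=` B -> fine (P A) <= fine (P B).
Proof.
move=> mA mB AB; rewrite -lee_fin -!probability_fine//.
by apply: le_measure; rewrite ?inE.
Qed.

Lemma measurable_discrete_rv (F : finType) (f : T -> F) (B : pred F) :
  discrete_rv f -> measurable [set w | B (f w)].
Proof.
move=> mf; rewrite (_ : mkset _ = \bigcup_(y in [set y | B y]) [set w | f w = y]).
  by apply: fin_bigcup_measurable.
by apply/seteqP; split=> [w Bw|w [y /= By ->//]]; exists (f w).
Qed.

Lemma probability_partition {F : finType} {f : T -> F} {A : set T} (B : pred F) :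
  measurable A -> discrete_rv f ->
  fine (P (A `&` [set w | B (f w)])) =
  \sum_(y | B y) fine (P (A `&` [set w | f w = y])).
Proof.
move=> mA mf; apply: EFin_inj.
rewrite -probability_fine; last first.
  by apply: measurableI => //; exact: measurable_discrete_rv.
rewrite (_ : A `&` _ = \bigcup_(y in [set` B]) (A `&` [set w | f w = y])); last first.
  apply/seteqP; split=> [w [Aw Bw]|w [y /= By [Aw ->//]]].
  by exists (f w).
rewrite measure_fin_bigcup//; last 2 first.
- by move=> y z _ _ [w [[_ <-] [_ <-]]].
- by move=> y _; apply: measurableI.
rewrite -(bigfs _ (index_enum_uniq F)); last by move=> y _; rewrite mem_index_enum.
rewrite -sumEFin; apply: eq_bigr => y _.
by rewrite -probability_fine//; apply: measurableI.
Qed.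

End finite_partition.

(** * Past and future of the chain given an intermediate state *)

Section markov.
Context {R : realType} {d : measure_display} {T : measurableType d}
  {P : probability T R} {n : nat} {Q : 'M[R]_n} {X : R -> T -> 'I_n}.
Hypothesis hX : is_ctmc P Q X.

Let mX t k : 0 <= t -> measurable [set w | X t w = k].
Proof. by case: hX => _ + _ _; exact. Qed.

Lemma measurable_states (t : nat -> R) (x : nat -> 'I_n) m : (forall q, 0 <= t q) ->
  measurable [set w | forall q, (q <= m)%N -> X (t q) w = x q].
Proof.
move=> t0; rewrite (_ : mkset _ = \bigcap_(q in `I_m.+1) [set w | X (t q) w = x q]).
  by apply: bigcap_measurable => [|q _]; [exists 0%N|exact: mX].
by apply/seteqP; split=> w /= H q /=; exact: H.
Qed.

Lemma markov_states (t : nat -> R) (x : nat -> 'I_n) m :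
  0 <= t 0%N -> {homo t : k l / (k < l)%N >-> k < l} ->
  fine (P [set w | forall q, (q <= m)%N -> X (t q) w = x q]) =
  fine (P [set w | X (t 0%N) w = x 0%N]) *
    \prod_(q < m) expm ((t q.+1 - t q) *: Q) (x q) (x q.+1).
Proof.
move=> t0 tlt; have t_ge0 q : 0 <= t q.
  by case: q => // q; rewrite (le_trans t0)// ltW// tlt.
elim: m => [|m IHm].
  rewrite big_ord0 mulr1; congr (fine (P _)); apply/seteqP; split=> w /=.
    by apply.
  by move=> w0 [|q].
case: hX => _ _ _ /(_ m t x t0 tlt) ->.
rewrite fineM//; last by rewrite fin_num_measure//; exact: measurable_states.
by rewrite IHm big_ord_recr/= mulrA.
Qed.

Section past_and_future.
Variables (s0 s1 r dt : R) (k l : 'I_n) (K : nat).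
Hypotheses (s0_ge0 : 0 <= s0) (s01 : s0 < s1) (s1r : s1 < r) (dt0 : 0 < dt).

Definition future w : {ffun 'I_K.+1 -> 'I_n} := [ffun q : 'I_K.+1 => X (r + q%:R * dt) w].

Let past : set T := [set w | X s0 w = k] `&` [set w | X s1 w = l].

Let s1_ge0 : 0 <= s1. Proof. exact/ltW/(le_lt_trans s0_ge0). Qed.

Let r_ge0 : 0 <= r. Proof. exact/ltW/(le_lt_trans s1_ge0). Qed.

Lemma measurable_past : measurable past.
Proof. by apply: measurableI; exact: mX. Qed.

Lemma discrete_rv_future : 0 <= r -> discrete_rv future.
Proof.
move=> r0 y; rewrite (_ : mkset _ = \bigcap_(q in [set: 'I_K.+1])
    [set w | X (r + q%:R * dt) w = y q]).
  apply: fin_bigcap_measurable => // q _; apply: mX.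
  by rewrite addr_ge0// mulr_ge0// ltW.
apply/seteqP; split=> w /=.
  by move=> <- q _; rewrite ffunE.
by move=> H; apply/ffunP => q; rewrite ffunE; exact: H.
Qed.

Let time q := match q with 0 => s0 | 1 => s1 | q'.+2 => r + q'%:R * dt end.

Let time_lt : {homo time : u v / (u < v)%N >-> u < v}.
Proof.
apply: homo_ltn; first exact: lt_trans.
case=> [|[|q]]//=; first by rewrite mul0r addr0.
by rewrite ltrD2l ltr_pM2r// ltr_nat.
Qed.

Let ftime q := r + q%:R * dt.

Let ftime_lt : {homo ftime : u v / (u < v)%N >-> u < v}.
Proof. by move=> u v uv; rewrite /ftime ltrD2l ltr_pM2r// ltr_nat. Qed.

(* The two sides have the same factors after time [r], so nothing has to be
   known about [expm]. *)
Lemma past_future_state (y : {ffun 'I_K.+1 -> 'I_n}) : y ord0 = l ->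
  fine (P (past `&` [set w | future w = y])) * fine (P [set w | X r w = l]) <=
  fine (P past) * fine (P [set w | future w = y]).
Proof.
move=> y0.
have [fx [fx0 futE]] : exists fx : nat -> 'I_n, fx 0%N = l /\
    forall w, future w = y <-> forall q, (q <= K)%N -> X (ftime q) w = fx q.
  exists (fun q => y (inord q)); split.
    by rewrite -y0; congr (y _); apply: val_inj; rewrite /= inordK.
  move=> w; split=> [wy q qK|H]; first by rewrite -wy ffunE inordK.
  by apply/ffunP => q; rewrite ffunE (H q) ?inord_val// -ltnS.
pose x q := match q with 0 => k | 1 => l | q'.+2 => fx q' end.
have -> : past `&` [set w | future w = y] =
    [set w | forall q, (q <= K.+2)%N -> X (time q) w = x q].
  apply/seteqP; split=> w /=.
    by move=> [[w0 w1] /futE wf] [|[|q]]//= qK; apply: wf; rewrite -ltnS -ltnS.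
  by move=> H; split; [split; [exact: (H 0%N)|exact: (H 1%N)]|apply/futE => q qK; exact: (H q.+2)].
have -> : [set w | future w = y] = [set w | forall q, (q <= K)%N -> X (ftime q) w = fx q].
  by apply/seteqP; split=> w /= /futE.
(* Dropping the constraint at time [r] is the one place where equality is lost. *)
have three : fine (P [set w | forall q, (q <= 2)%N -> X (time q) w = x q]) <= fine (P past).
  apply: le_fine_probability.
  - by apply: measurable_states => -[|[|q]]/=; rewrite ?addr_ge0 ?mulr_ge0 ?(ltW dt0).
  - exact: measurable_past.
  - by move=> w /= H; split; [exact: (H 0%N)|exact: (H 1%N)].
have : 0 <= fine (P [set w | forall q, (q <= K)%N -> X (ftime q) w = fx q]).
  exact: fine_probability_ge0.
move: three; rewrite !markov_states// /ftime/= ?mul0r ?addr0 ?fx0//.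
rewrite !big_ord_recl !big_ord0 /= mul0r addr0 mulr1.
set p0 := fine (P [set w | X s0 w = k]); set pr := fine (P [set w | X r w = l]).
set p1 := expm _ k l; set p2 := expm _ l _.
move=> three; set pi := \prod_(q < K) _ => pi0.
rewrite -[X in p2 * X]/pi.
have -> : p0 * (p1 * (p2 * pi)) * pr = p0 * (p1 * p2) * (pr * pi) by ring.
exact: ler_wpM2r.
Qed.

(** Conditional independence given the state [l] at time [r], as an inequality without division: the
    bound for single futures is summed over those that start in [l]. *)
Lemma past_future (B : pred {ffun 'I_K.+1 -> 'I_n}) :
  fine (P (past `&` [set w | (future w ord0 == l) && B (future w)])) *
    fine (P [set w | X r w = l]) <=
  fine (P past) * fine (P [set w | B (future w)]).
Proof.
have mf := discrete_rv_future r_ge0; have mp := measurable_past.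
rewrite (probability_partition (fun y : {ffun 'I_K.+1 -> 'I_n} => (y ord0 == l) && B y) mp mf).
rewrite -[X in _ <= _ * fine (P X)]setTI (probability_partition B measurableT mf).
rewrite mulr_suml mulr_sumr [leRHS](bigID (fun y : {ffun 'I_K.+1 -> 'I_n} => y ord0 == l))/=.
rewrite ler_wpDr ?sumr_ge0// => [y _|].
  by rewrite mulr_ge0 ?fine_probability_ge0.
under eq_bigl do rewrite andbC.
by apply: ler_sum => y /andP[_ /eqP y0]; rewrite setTI past_future_state.
Qed.

End past_and_future.
End markov.

Lemma probability_bigsetU_le {R : realType} {d : measure_display} {T : measurableType d}
    (P : probability T R) (M : nat) (A : nat -> set T) : (forall m, measurable (A m)) ->
  fine (P (\big[setU/set0]_(m < M) A m)) <= \sum_(m < M) fine (P (A m)).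
Proof.
move=> mA; elim: M => [|M IHM]; first by rewrite !big_ord0 measure0.
rewrite !big_ord_recr/=; have mU : measurable (\big[setU/set0]_(m < M) A m).
  by apply: bigsetU_measurable.
apply: le_trans (lerD IHM (lexx _)).
rewrite -lee_fin EFinD -!probability_fine//; last exact: measurableU.
exact: measureU2.
Qed.

Lemma probability_cvg0 {R : realType} {d : measure_display} {T : measurableType d}
    (P : probability T R) (S : nat -> set T) : (forall m, measurable (S m)) ->
  (forall w, \forall m \near \oo, ~ S m w) -> fine (P (S m)) @[m --> \oo] --> 0.
Proof.
move=> mS S0; apply: fine_cvg.
have mI m : measurable_fun setT (fun w => (\1_(S m) w)%:E : \bar R).
  by apply/measurable_EFinP; exact: measurable_indic.
have I1 : P.-integrable setT (cst 1%E) by exact: finite_measure_integrable_cst.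
have cv w : setT w -> (\1_(S m) w)%:E @[m --> \oo] --> (0%E : \bar R).
  by move=> _; apply: cvg_near_cst; apply: filterS (S0 w) => m Sm; rewrite indicE memNset.
have le1 m w : setT w -> (`|(\1_(S m) w)%:E| <= 1%E :> \bar R)%E.
  by move=> _; rewrite abse_EFin lee_fin indicE; case: (_ \in _); rewrite ?normr1 ?normr0.
have fin1 (w : T) : setT w -> cst (1%E : \bar R) w \is a fin_num by [].
have := dominated_cvg measurableT mI cv fin1 I1 le1.
rewrite integral0; apply: cvg_trans; apply: near_eq_cvg; apply: nearW => m.
by rewrite integral_indic// setIT.
Qed.

(** Two integers in an open interval of length 4 differ by less than 4, so their residues modulo 4
    tell them apart. *)
Lemma card_near_le4 {R : realType} (M : nat) (z : R) :
  (#|[pred m : 'I_M | (`|z - m%:R| < 2)%R]| <= 4)%N.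
Proof.
rewrite -[leqRHS](card_ord 4).
apply: (@leq_card_in _ _ (fun m : 'I_M => inord (m %% 4) : 'I_4)) => m m'.
rewrite !inE => zm zm' /(congr1 val)/=; rewrite !inordK ?ltn_mod// => mm.
apply: val_inj => /=.
have D (u v : nat) : `|z - u%:R| < 2 -> `|z - v%:R| < 2 -> (u < v + 4)%N.
  rewrite !ltr_norml => /andP[? ?] /andP[? ?].
  by rewrite -(ltr_nat R) natrD; lra.
have := D _ _ zm zm'; have := D _ _ zm' zm; lia.
Qed.

(** * Jump probabilities over short intervals *)

Section transition_decay.
Context {R : realType} {d : measure_display} {T : measurableType d}
  {P : probability T R} {n : nat} {Q : 'M[R]_n} {X : R -> T -> 'I_n}.
Hypothesis hX : is_ctmc P Q X.

(* The transition probability is [expm (h *: Q) k l] as soon as the state [k]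
   has positive probability at one time, and then right continuity makes it
   vanish with [h]. *)
Lemma transition_decay k l (h : nat -> R) : k != l -> (forall m, 0 < h m) ->
  h @ \oo --> 0 -> exists2 u : nat -> R, u @ \oo --> 0 &
    forall m s, 0 <= s ->
      fine (P ([set w | X s w = k] `&` [set w | X (s + h m) w = l])) <= u m.
Proof.
move=> kl h0 hcv.
have mX t k' : 0 <= t -> measurable [set w | X t w = k'].
  by case: hX => _ + _ _; exact.
have two m s : 0 <= s ->
    fine (P ([set w | X s w = k] `&` [set w | X (s + h m) w = l])) =
    fine (P [set w | X s w = k]) * expm (h m *: Q) k l.
  move=> s0.
  have tlt : {homo (fun q : nat => s + q%:R * h m) : u v / (u < v)%N >-> u < v}.
    by move=> u v uv; rewrite ltrD2l ltr_pM2r// ltr_nat.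
  have := markov_states hX (fun q : nat => s + q%:R * h m)
    (fun q => if q is 0%N then k else l) 1.
  rewrite /= mul0r addr0 => /(_ s0 tlt).
  rewrite big_ord1/= mul0r addr0 mul1r addrAC subrr add0r => <-.
  congr (fine (P _)); apply/seteqP; split=> w /=.
    by move=> [w0 w1] [|[|q]]//=; rewrite ?mul0r ?addr0// mul1r.
  by move=> H; have := H 0%N isT; have := H 1%N isT; rewrite /= mul1r mul0r addr0.
have [[t0 t0_ge0 pt0]|no] :=
    pselect (exists2 t0, 0 <= t0 & 0 < fine (P [set w | X t0 w = k])).
  (* This is the transition probability over time [h m], read off at the reference time [t0] and so
     independent of [s]. *)
  pose u m := fine (P ([set w | X t0 w = k] `&` [set w | X (t0 + h m) w = l])) /
              fine (P [set w | X t0 w = k]).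
  exists u.
    rewrite -[X in _ --> X](mul0r (fine (P [set w | X t0 w = k]))^-1).
    apply: cvgMr_tmp; apply: probability_cvg0 => [m|w].
      by apply: measurableI; apply: mX; rewrite ?addr_ge0// ltW.
    have X_right t : 0 <= t -> \forall s \near t^'+, X s w = X t w.
      by case: hX => _ _ + _; exact.
    have [e e0 He] := right_constantP X_right t0 t0_ge0.
    have : \forall m \near \oo, h m < e by apply: cvgr_lt hcv _ _.
    apply: filterS => m hm [w0 w1]; move/eqP: kl; apply.
    by rewrite -w0 -w1 He// lerDl ltrD2l hm ltW.
  move=> m s s0; rewrite two// /u two// mulrAC divff ?gt_eqF// mul1r.
  have u0 : 0 <= expm (h m *: Q) k l.
    rewrite -(pmulr_rge0 _ pt0) -two//; exact: fine_probability_ge0.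
  apply: ler_piMl => //; rewrite -lee_fin -probability_fine ?probability_le1//; exact: mX.
exists (fun=> 0); first exact: cvg_cst.
move=> m s s0; rewrite two//.
have -> : fine (P [set w | X s w = k]) = 0; last by rewrite mul0r.
apply/eqP; rewrite eq_le fine_probability_ge0 andbT leNgt; apply/negP => ps.
by apply: no; exists s.
Qed.

End transition_decay.

(** * Jump times compatible with a given weighted sum *)

Section two_level_event.
Context {R : realType} {d : measure_display} {T : measurableType d}
  {P : probability T R} {n : nat} {Q : 'M[R]_n} {X : R -> T -> 'I_n}.
Hypothesis hX : is_ctmc P Q X.
Variables (b : 'I_n -> R) (k l : 'I_n) (c : R) (p a : nat).
Hypotheses (bkl : b k != b l) (ap : (a <= p)%N).

(** The mesh [dt] divides everything: a cell of length [h L] has [N.+1] steps, [r] is a multiple of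
    [dt], and [K] steps lead from [r] to 1. *)
Let r : R := a.+1%:R / p.+1%:R.
Let h (L : nat) : R := (p.+1 * L.+1)%:R^-1.
Let dt (L N : nat) : R := (p.+1 * L.+1 * N.+1)%:R^-1.
Let K (L N : nat) : nat := (p - a) * L.+1 * N.+1.
Let past L m := [set w | X (m%:R * h L) w = k] `&` [set w | X (m%:R * h L + h L) w = l].
Let fut L N := future (X := X) r (dt L N) (K L N).

Let future_sum L N (y : {ffun 'I_(K L N).+1 -> 'I_n}) :=
  dt L N * \sum_(q < K L N) b (y (widen_ord (leqnSn _) q)).

(** A jump exactly at time t would give c = t b_k + (r - t) b_l plus the part after [r]. The test is
    this equation at the left end of cell [m], with a tolerance of two cell widths: one for
    sampling, one for the position of the jump in its cell. *)
Let hit L N m (y : {ffun 'I_(K L N).+1 -> 'I_n}) : bool :=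
  `|c - r * b l - future_sum L N y - m%:R * (h L * (b k - b l))| < 2 * `|h L * (b k - b l)|.

(* The first jump falls in one of the cells of length [h L], and the states
   after time [r], sampled with mesh [dt L N], are compatible with a weighted sum
   equal to [c].  Each value of these states is compatible with at most four
   cells. *)
Definition near_atom L N : set T := \big[setU/set0]_(m < a * L.+1)
  (past L m `&` [set w | (fut L N w ord0 == l) && hit L N m (fut L N w)]).

Let h0 L : 0 < h L. Proof. by rewrite invr_gt0 ltr0n muln_gt0. Qed.

Let r_ge0 : 0 <= r. Proof. by rewrite divr_ge0. Qed.

Let dt0 L N : 0 < dt L N. Proof. by rewrite invr_gt0 ltr0n !muln_gt0. Qed.

Let dth L N : N.+1%:R * dt L N = h L.
Proof. by rewrite /dt natrM invfM mulrCA divff ?pnatr_eq0// mulr1. Qed.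

Let dtr L N : (a.+1 * L.+1 * N.+1)%:R * dt L N = r.
Proof.
rewrite /dt !natrM !invfM mulrACA divff ?pnatr_eq0// mulr1.
by rewrite mulrACA divff ?pnatr_eq0// mulr1.
Qed.

Let mh_ge0 L m : 0 <= m%:R * h L. Proof. by rewrite mulr_ge0// ltW. Qed.

Let mhS L m : m%:R * h L + h L = m.+1%:R * h L.
Proof. by rewrite -natr1 mulrDl mul1r. Qed.

Let mh_lt L m : (m < a * L.+1)%N -> m%:R * h L + h L < r.
Proof.
move=> ma; rewrite mhS.
apply: (@le_lt_trans _ _ ((a * L.+1)%:R * h L)).
  by rewrite ler_pM2r// ler_nat.
rewrite /h /r natrM natrM invfM mulrACA divff ?pnatr_eq0// mulr1.
by rewrite ltr_pM2r ?invr_gt0// ltr_nat.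
Qed.

Let mh_past L m : m%:R * h L < m%:R * h L + h L. Proof. by rewrite ltrDl. Qed.

Let measurable_cell L N m : (m < a * L.+1)%N ->
  measurable (past L m `&` [set w | (fut L N w ord0 == l) && hit L N m (fut L N w)]).
Proof.
move=> ma; apply: measurableI; first exact: (measurable_past hX).
apply: (measurable_discrete_rv {ffun 'I_(K L N).+1 -> 'I_n} (fut L N)
  (fun y => (y ord0 == l) && hit L N m y)).
exact: (discrete_rv_future hX).
Qed.

Lemma measurable_near_atom L N : measurable (near_atom L N).
Proof. by apply: bigsetU_measurable => m _; exact: measurable_cell. Qed.

(** After a union bound, [past_future] separates in each cell the jump, of probability at most [u],
    from the future. Exchanging the sums then counts the cells that a given future hits, so the
    number of cells does not enter. *)
Lemma probability_near_atom L N (u : R) : 0 <= u ->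
  (forall s, 0 <= s -> fine (P ([set w | X s w = k] `&` [set w | X (s + h L) w = l])) <= u) ->
  fine (P (near_atom L N)) * fine (P [set w | X r w = l]) <= 4 * u.
Proof.
move=> u0 hu.
have mf : discrete_rv (fut L N) by exact: (discrete_rv_future hX).
have pr0 := fine_probability_ge0 (P := P).
pose A m := if (m < a * L.+1)%N then
  past L m `&` [set w | (fut L N w ord0 == l) && hit L N m (fut L N w)] else set0.
have -> : near_atom L N = \big[setU/set0]_(m < a * L.+1) A m.
  by apply: eq_bigr => m _; rewrite /A ltn_ord.
apply: (@le_trans _ _ ((\sum_(m < a * L.+1) fine (P (A m))) * fine (P [set w | X r w = l]))).
  rewrite ler_wpM2r//; apply: probability_bigsetU_le => m; rewrite /A.
  by case: ifP => // ma; exact: measurable_cell.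
rewrite mulr_suml.
apply: (@le_trans _ _ (\sum_(m < a * L.+1)
    u * \sum_(y | hit L N m y) fine (P [set w | fut L N w = y]))).
  apply: ler_sum => m _; rewrite /A ltn_ord.
  have PF := past_future hX _ _ _ _ _ _ _
    (mh_ge0 L m) (mh_past L m) (mh_lt L m (ltn_ord m)) (dt0 L N) (hit L N m).
  apply: (le_trans (PF k l)).
  rewrite -[X in _ * fine (P X) <= _]setTI (probability_partition (hit L N m) measurableT mf).
  under eq_bigr do rewrite setTI.
  by rewrite ler_wpM2r ?sumr_ge0//; exact: hu.
rewrite -mulr_sumr mulrC ler_wpM2r//.
under eq_bigr do rewrite big_mkcond/=.
rewrite exchange_big/=.
apply: (@le_trans _ _ (\sum_(y : {ffun 'I_(K L N).+1 -> 'I_n}) 4 * fine (P [set w | fut L N w = y]))).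
  apply: ler_sum => y _; rewrite -big_mkcond/= sumr_const -[leLHS]mulr_natl ler_wpM2r//.
  rewrite (ler_nat _ _ 4).
  set v := c - r * b l - future_sum L N y.
  (* Division by the signed cell width turns [hit] into a distance less than 2 between [m] and a
     fixed real number. *)
  apply: leq_trans (card_near_le4 _ (v / (h L * (b k - b l)))).
  apply: subset_leq_card; apply/fintype.subsetP => m; rewrite inE /in_mem/= /hit -/v => vm.
  have B0 : h L * (b k - b l) != 0 by rewrite mulf_neq0 ?subr_eq0// gt_eqF.
  rewrite -(ltr_pM2r (_ : 0 < `|h L * (b k - b l)|)) ?normr_gt0// -normrM.
  by rewrite mulrBl divfK.
rewrite -mulr_sumr -[leRHS]mulr1 ler_wpM2l//.
have := probability_partition xpredT measurableT mf (P := P).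
under eq_bigr do rewrite setTI.
move=> <-; rewrite (_ : _ `&` _ = setT); first by rewrite probability_setT.
by apply/seteqP; split.
Qed.

Hypothesis X_right : forall w (t : R), 0 <= t -> \forall s \near t^'+, X s w = X t w.

(** The cells stay fixed while the sampling mesh shrinks, so the sampled sum comes within one cell
    width of [c]. *)
Lemma near_atom_eventually L w tau : 0 < tau <= a%:R / p.+1%:R ->
  (forall t, 0 <= t < tau -> X t w = k) -> (forall t, tau <= t <= r -> X t w = l) ->
  weighted_sum X b w = c -> \forall N \near \oo, near_atom L N w.
Proof.
move=> /andP[tau0 taua] Xk Xl Wc.
(* The cell of the jump ends at the least multiple of [h L] that is at least [tau]. *)
have [m ma /andP[mtau taum]] : exists2 m, (m < a * L.+1)%N &
    m%:R * h L < tau <= m%:R * h L + h L.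
  have ex : exists j, tau <= j%:R * h L.
    exists (a * L.+1)%N; apply: (le_trans taua).
    by rewrite /h !natrM invfM mulrACA divff ?pnatr_eq0// mulr1.
  case: (ex_minnP ex) => -[|m] tm mmin.
    by move: tm; rewrite mul0r leNgt tau0.
  exists m.
    apply: mmin; apply: (le_trans taua).
    by rewrite /h !natrM invfM mulrACA divff ?pnatr_eq0// mulr1.
  rewrite mhS tm andbT ltNge; apply/negP => /mmin.
  by rewrite ltnn.
have hb0 : 0 < `|h L * (b k - b l)|.
  by rewrite normr_gt0 mulf_neq0 ?subr_eq0// gt_eqF.
have /cvgrPdist_lt /(_ _ hb0)[N0 _ HN0] := weighted_sum_cvg X_right b w.
exists N0 => // N /= N0N.
set N' := (p.+1 * L.+1 * N.+1)%N.
have N'N : (N0 <= N')%N.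
  by apply: (leq_trans N0N); rewrite (leq_trans (leqnSn N))// leq_pmull// muln_gt0.
have := HN0 _ N'N; rewrite Wc weighted_sum_sampled ?muln_gt0// => WN.
pose B q := b (X (q%:R * dt L N) w).
pose A1 := (a.+1 * L.+1 * N.+1)%N.
have N'E : N' = (A1 + K L N)%N.
  by rewrite /N' /A1 /K -!mulnDl addSn subnKC.
have timeE q m' : (q%:R * dt L N < m'%:R * h L) = (q < m' * N.+1)%N.
  by rewrite -(dth L N) mulrA -natrM ltr_pM2r// ltr_nat.
have m12 : (m * N.+1 <= m.+1 * N.+1)%N by rewrite leq_mul.
have m2A : (m.+1 * N.+1 <= A1)%N.
  by rewrite leq_mul// (leq_trans ma)// leq_mul.
have Bk q : (q < m * N.+1)%N -> B q = b k.
  move=> qm; rewrite /B Xk// mulr_ge0// ?(ltW (dt0 _ _))//=.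
  by apply: lt_trans mtau; rewrite timeE.
have Bl q : (m.+1 * N.+1 <= q <= A1)%N -> B q = b l.
  move=> /andP[mq qA]; rewrite /B Xl// -[r](dtr L N) ler_pM2r// ler_nat qA andbT.
  by apply: (le_trans taum); rewrite mhS leNgt timeE -leqNgt.
have Bkl q : (m * N.+1 <= q < m.+1 * N.+1)%N -> `|B q - b l| <= `|b k - b l|.
  move=> /andP[mq qm]; rewrite /B; have [qtau|qtau] := ltP (q%:R * dt L N) tau.
    by rewrite Xk// qtau mulr_ge0// ltW.
  rewrite Xl ?subrr ?normr0// qtau/= -[r](dtr L N) ler_pM2r// ler_nat.
  by rewrite (leq_trans (ltnW qm)).
(* The sampled path is known before [r] except in the cell of the jump, where it
   deviates from [l] by at most the width of the cell. *)
pose E := \sum_(m * N.+1 <= q < m.+1 * N.+1) (B q - b l).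
have EB : `|E| <= N.+1%:R * `|b k - b l|.
  apply: le_trans (ler_norm_sum _ _ _) _.
  apply: (@le_trans _ _ (\sum_(m * N.+1 <= q < m.+1 * N.+1) `|b k - b l|)).
    by rewrite !big_nat; apply: ler_sum => q /Bkl.
  by rewrite sumr_const_nat mulSn addnK mulr_natl.
have futE : \sum_(A1 <= q < N') B q =
    \sum_(q < K L N) b (fut L N w (widen_ord (leqnSn _) q)).
  rewrite -{1}[A1]add0n big_addn N'E addKn big_mkord; apply: eq_bigr => q _.
  by rewrite /B /fut ffunE/= natrD mulrDl dtr addrC.
have SE : \sum_(q < N') B q = (m * N.+1)%:R * b k + (E + N.+1%:R * b l) +
    (A1 - m.+1 * N.+1)%:R * b l + \sum_(A1 <= q < N') B q.
  rewrite -(big_mkord xpredT B) (@big_cat_nat _ _ _ A1) ?N'E ?leq_addr//=; congr (_ + _).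
  rewrite (@big_cat_nat _ _ _ (m.+1 * N.+1)%N)//=.
  rewrite (@big_cat_nat _ _ _ (m * N.+1)%N _ (m.+1 * N.+1)%N)//=.
  congr (_ + _ + _).
  - rewrite (eq_big_nat _ _ (F2 := fun=> b k)) => [|q /andP[_ /Bk]//].
    by rewrite sumr_const_nat subn0 mulr_natl.
  - rewrite /E sumrB sumr_const_nat mulSn addnK mulr_natl subrK//.
  - rewrite (eq_big_nat _ _ (F2 := fun=> b l)) => [|q /andP[mq /ltnW qA]]; last first.
      by apply: Bl; rewrite mq.
    by rewrite sumr_const_nat mulr_natl.
rewrite /near_atom -(bigcup_mkord _ (fun m => past L m `&`
  [set w | (fut L N w ord0 == l) && hit L N m (fut L N w)])).
exists m => //; split.
  split; rewrite /=; first by rewrite Xk// mh_ge0.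
  rewrite Xl// taum/= ltW// mh_lt//.
rewrite /=; apply/andP; split.
  by rewrite /fut ffunE mul0r addr0 Xl// lexx andbT (le_trans taua)// ler_pM2r ?invr_gt0// ler_nat.
rewrite /hit /future_sum -futE.
move: WN; rewrite [\sum_(q < _) _](_ : _ = \sum_(q < N') B q)// SE -/(dt L N).
set fs := \sum_(A1 <= q < N') B q => WN.
(* The error of the sampled sum plus the deviation [dt L N * E] within the cell of the jump: each
   accounts for one of the two cell widths allowed by [hit]. *)
have -> : c - r * b l - dt L N * fs - m%:R * (h L * (b k - b l)) =
  c - dt L N * ((m * N.+1)%:R * b k + (E + N.+1%:R * b l) +
    (A1 - m.+1 * N.+1)%:R * b l + fs) + dt L N * E.
  rewrite natrB// -[r](dtr L N) -/A1 -(dth L N) !natrM; ring.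
apply: le_lt_trans (ler_normD _ _) _.
rewrite [ltRHS]mulr_natl mulr2n; apply: ltr_leD => //.
rewrite normrM gtr0_norm// normrM (gtr0_norm (h0 L)) -(dth L N).
by rewrite mulrAC [X in _ <= X]mulrC ler_pM2l//.
Qed.

End two_level_event.

(** * Non-constant paths reach a given weighted sum with probability zero *)

Section atoms.
Context {R : realType} {d : measure_display} {T : measurableType d}
  {P : probability T R} {n : nat} {Q : 'M[R]_n} {X : R -> T -> 'I_n}.
Hypothesis hX : is_ctmc P Q X.

Let mX t k : 0 <= t -> measurable [set w | X t w = k].
Proof. by case: hX => _ + _ _; exact. Qed.

Let X_right w (t : R) : 0 <= t -> \forall s \near t^'+, X s w = X t w.
Proof. by case: hX => _ _ + _; exact. Qed.

(** For each [L] the set [A] lies in the lower limit of [B L N] in [N], of probability at most [u L]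
    by continuity from below. Intersecting over [L] gives a measurable null cover, with no
    measurability asked of [A]. *)
Lemma negligible_le_cvg0 (A : set T) (B : nat -> nat -> set T) (u : nat -> R) :
  (forall L N, measurable (B L N)) -> (forall L N, fine (P (B L N)) <= u L) ->
  u @ \oo --> 0 -> (forall L w, A w -> \forall N \near \oo, B L N w) ->
  P.-negligible A.
Proof.
move=> mB Bu u0 AB.
pose C L N := \bigcap_(M in [set M | (N <= M)%N]) B L M.
have mC L N : measurable (C L N).
  by apply: bigcap_measurable => //; exists N => /=.
have mUC L : measurable (\bigcup_N C L N) by exact: bigcupT_measurable.
have CB L : (P (\bigcup_N C L N) <= (u L)%:E)%E.
  have ndC : nondecreasing_seq (C L).
    by move=> N N' NN'; apply/subsetPset => w Cw M /= /(leq_trans NN'); exact: Cw.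
  have := nondecreasing_cvg_mu (mC L) (mUC L) ndC (mu := P).
  move=> cv; rewrite -(cvg_lim _ cv)//; apply: lime_le; first by apply/cvg_ex; eexists; exact: cv.
  apply: nearW => N /=; rewrite probability_fine// lee_fin.
  apply: le_trans (Bu L N); apply: le_fine_probability => //.
  by move=> w; apply => /=.
exists (\bigcap_L \bigcup_N C L N); split.
- exact: bigcapT_measurable.
- apply/eqP; rewrite eq_le measure_ge0 andbT.
  have mI : measurable (\bigcap_L \bigcup_N C L N) by exact: bigcapT_measurable.
  rewrite probability_fine// lee_fin.
  rewrite -(cvg_lim _ u0)//; apply: limr_ge; first by apply/cvg_ex; eexists; exact: u0.
  apply: nearW => L; rewrite -lee_fin -probability_fine//.
  apply: le_trans (CB L); apply: le_measure; rewrite ?inE// => w; exact.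
- move=> w Aw L _; have [N _ HN] := AB L w Aw.
  by exists N => // M /= NM; exact: HN.
Qed.

Variables (b : 'I_n -> R) (c : R).

(** The gap between the bound on [tau] and the time up to which [l] lasts keeps every cell that may
    contain the jump strictly before the future. *)
Let jump_event k l p a : set T := [set w | exists tau : R,
  [/\ 0 < tau <= a%:R / p.+1%:R, (forall t, 0 <= t < tau -> X t w = k),
      (forall t, tau <= t <= a.+1%:R / p.+1%:R -> X t w = l) &
      weighted_sum X b w = c]].

Let negligible_jump_event k l p a : b k != b l -> (a <= p)%N ->
  P.-negligible (jump_event k l p a).
Proof.
move=> bkl ap.
pose r : R := a.+1%:R / p.+1%:R.
have r0 : 0 <= r by rewrite divr_ge0.
have kl : k != l by apply: contra bkl => /eqP ->.
(* The estimate is to be divided by this probability; if it vanishes, the event lies in a null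
   set. *)
have [pr|pr] := eqVneq (fine (P [set w | X r w = l])) 0.
  exists [set w | X r w = l]; split.
  - exact: mX.
  - by rewrite probability_fine ?pr//; exact: mX.
  - move=> w [tau [/andP[_ taua] _ + _]]; apply.
    by rewrite lexx andbT (le_trans taua)// ler_pM2r ?invr_gt0// ler_nat.
have pr0 : 0 < fine (P [set w | X r w = l]).
  by rewrite lt_neqAle eq_sym pr fine_probability_ge0.
pose h L : R := (p.+1 * L.+1)%:R^-1.
have h0 L : 0 < h L by rewrite invr_gt0 ltr0n muln_gt0.
have hcv : h @ \oo --> 0.
  rewrite -(mulr0 p.+1%:R^-1) (_ : h = fun L => p.+1%:R^-1 * harmonic L).
    by apply: cvgMl_tmp; exact: cvg_harmonic.
  by apply/funext => L; rewrite /h natrM invfM.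
have [u u0 hu] := transition_decay hX k l h kl h0 hcv.
have u_ge0 L : 0 <= u L by apply: le_trans (hu L 0 (lexx _)); exact: fine_probability_ge0.
apply: (negligible_le_cvg0 _ (near_atom (X := X) b k l c p a)
  (fun L => 4 * u L / fine (P [set w | X r w = l]))).
- by move=> L N; exact: (measurable_near_atom hX).
- move=> L N; rewrite ler_pdivlMr//.
  by apply: (probability_near_atom hX) => // s s0; exact: hu.
- rewrite -(mul0r (fine (P [set w | X r w = l]))^-1) -(mulr0 4).
  by apply: cvgMr_tmp; apply: cvgMl_tmp.
- move=> L w [tau [tau0 Xk Xl Wc]].
  by apply: near_atom_eventually tau0 Xk Xl Wc.
Qed.

Hypothesis b_inj : forall k l, k != l -> b k != b l.

(** The first exit time from the initial state, together with a grid fine enough for the path to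
    rest in the new state, places each such path in one of countably many jump events. *)
Lemma negligible_atom : P.-negligible
  [set w | weighted_sum X b w = c /\ exists2 t, 0 <= t < 1 & X t w <> X 0 w].
Proof.
pose F (i : nat) : set T :=
  if (unpickle i : option ('I_n * 'I_n * nat * nat)) is Some (k, l, p, a) then
    if (k != l) && (a <= p)%N then jump_event k l p a else set0 else set0.
apply: (@negligibleS _ _ _ P (\bigcup_i F i)); last first.
  apply: negligible_bigcup => i; rewrite /F.
  case: unpickle => [[[[k l] p] a]|]; last exact: negligible_set0.
  case: ifP => [/andP[kl ap]|_]; last exact: negligible_set0.
  by apply: negligible_jump_event => //; exact: b_inj.
move=> w [Wc [t1 /andP[t10 t11] Xt1]].
pose S := [set t : R | 0 <= t /\ X t w <> X 0 w].
have S1 : S t1 by [].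
have S0 : lbound S 0 by move=> t [].
have infS : has_inf S by split; [exists t1|exists 0].
pose tau := inf S.
have before t : 0 <= t < tau -> X t w = X 0 w.
  move=> /andP[t0 tt]; apply: contrapT => Xt.
  by move: tt; rewrite ltNge => /negP; apply; apply: ge_inf => //; exists 0.
have tau0' : 0 <= tau by apply: lb_le_inf => //; exists t1.
have tau1 : tau <= t1 by apply: ge_inf => //; exists 0.
have [e e0 He] := @right_constantP _ _ (X ^~ w) (X_right w) tau tau0'.
(* Otherwise right continuity would keep the path in its initial state beyond the infimum [tau]. *)
have Xtau : X tau w <> X 0 w.
  move=> Xtau; have : tau + e <= tau; last by rewrite gerDl leNgt e0.
  apply: lb_le_inf; first by exists t1.
  move=> t [t0 Xt]; rewrite leNgt; apply/negP => te; apply: Xt.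
  have [tt|tt] := ltP t tau; first by rewrite before// t0.
  by rewrite He// tt.
have tau0 : 0 < tau.
  by rewrite lt_neqAle tau0' andbT; apply/eqP => tau00; apply: Xtau; rewrite -tau00.
(* Within [g] after [tau] the path is still in its new state and time 1 has not been reached. Then
   [p] makes two grid steps shorter than [g], and [a] indexes the first grid point after [tau]. *)
pose g := Num.min e (1 - tau).
have g0 : 0 < g by rewrite lt_min e0 subr_gt0 (le_lt_trans tau1).
pose p := Num.truncn (2 / g).
pose a := (Num.truncn (tau * p.+1%:R)).+1.
have p0 : 0 < p.+1%:R :> R by rewrite ltr0n.
have pg : 2 / p.+1%:R < g.
  by rewrite ltr_pdivrMr// mulrC -ltr_pdivrMr// truncnS_gt.
have /andP[a1 a2] : a.-1%:R <= tau * p.+1%:R < a%:R by apply: truncn_itv; rewrite mulr_ge0.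
have taua : tau <= a%:R / p.+1%:R by rewrite ler_pdivlMr// ltW.
have ra : a.+1%:R / p.+1%:R < tau + g.
  apply: le_lt_trans (_ : tau + 2 / p.+1%:R < _); last by rewrite ltrD2l.
  rewrite ler_pdivrMr// mulrDl divfK ?gt_eqF//.
  by rewrite -addn1 -[a]prednK// addn1 -addn2 natrD lerD2r.
have ap : (a <= p)%N.
  have : a.+1%:R / p.+1%:R < 1 :> R.
    by apply: (lt_le_trans ra); rewrite -lerBrDl ge_min lexx orbT.
  by rewrite ltr_pdivrMr// mul1r ltr_nat ltnS => /ltnW.
exists (pickle (X 0 w, X tau w, p, a)); first exact: Logic.I.
rewrite /F pickleK ap andbT ifT; last by apply/eqP => /esym.
exists tau; split=> //; first by rewrite tau0.
move=> t /andP[tt tr]; apply: He; rewrite tt (le_lt_trans tr)// (lt_le_trans ra)//.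
by rewrite lerD2l ge_min lexx.
Qed.

End atoms.

(** * The bound and the limits *)

Section truncated_exponential.
Context {R : realType} (rho rate : R).

Lemma gN_ge0 N x : 0 <= gN rho rate N x.
Proof. by rewrite le_min ler01 expR_ge0. Qed.

Lemma gN_le1 N x : gN rho rate N x <= 1.
Proof. by rewrite ge_min lexx. Qed.

Lemma glim_ge0 x : 0 <= glim rho rate x.
Proof. by rewrite /glim indicE. Qed.

Lemma measurable_gN N : measurable_fun setT (gN rho rate N).
Proof.
apply: measurable_minr => //; apply: measurableT_comp => //.
apply: measurableT_comp => //; apply: measurable_funM => //.
exact: measurable_funB.
Qed.

Lemma measurable_glim : measurable_fun setT (glim rho rate).
Proof. by apply: measurable_indic; exact: measurable_itv. Qed.

(* At the discontinuity [rho * rate] of the limit, convergence needs the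
   sequence to sit at this point. *)
Lemma gN_cvg (x : nat -> R) (y : R) : x @ \oo --> y ->
  (y = rho * rate -> \forall N \near \oo, x N = y) ->
  gN rho rate N (x N) @[N --> \oo] --> glim rho rate y.
Proof.
move=> xy xc; rewrite /glim indicE.
have [cy|yc] := ltP (rho * rate) y.
  rewrite memNset/=; last by rewrite in_itv/= => /(lt_le_trans cy); rewrite ltxx.
  (* With half of the gap as margin, [gN] is eventually below the geometric sequence exp(-e)^N. *)
  pose e := (y - rho * rate) / 2.
  have e0 : 0 < e by rewrite divr_gt0// subr_gt0.
  apply: (@squeeze_cvgr _ _ _ _ (fun=> 0) (fun N => expR (- e) ^+ N)).
  - have : \forall N \near \oo, rho * rate + e < x N.
      by apply: cvgr_gt xy _ _; rewrite /e; lra.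
    apply: filterS => N xN; rewrite gN_ge0/= ge_min; apply/orP; right.
    rewrite -expRM_natl ler_expR mulrN lerN2 ler_wpM2l//; lra.
  - exact: cvg_cst.
  - by apply: cvg_expr; rewrite ger0_norm ?expR_ge0// expR_lt1 oppr_lt0.
rewrite mem_set ?in_itv//=; apply: cvg_near_cst.
move: yc; rewrite le_eqVlt => /predU1P[yc|yc].
  apply: filterS (xc yc) => N ->; rewrite /gN yc subrr mulr0 oppr0 expR0.
  by rewrite /Num.min ltxx.
have : \forall N \near \oo, x N < rho * rate by apply: cvgr_lt xy _ _.
apply: filterS => N xN; rewrite /gN min_l//.
rewrite -[leLHS]expR0 ler_expR -mulrN mulr_ge0// oppr_ge0 subr_le0; exact: ltW.
Qed.

End truncated_exponential.

Section weighted_sum_measurable.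
Context {R : realType} {d : measure_display} {T : measurableType d}
  {P : probability T R} {n : nat} {Q : 'M[R]_n} {X : R -> T -> 'I_n}.
Hypothesis hX : is_ctmc P Q X.
Variable b : 'I_n -> R.

Let mX t k : 0 <= t -> measurable [set w | X t w = k].
Proof. by case: hX => _ + _ _; exact. Qed.

Let X_right w (t : R) : 0 <= t -> \forall s \near t^'+, X s w = X t w.
Proof. by case: hX => _ _ + _; exact. Qed.

Lemma discrete_rv_channel_states N : discrete_rv (channel_states X N).
Proof.
move=> s; rewrite (_ : mkset _ = \bigcap_(q in [set: 'I_N.+1])
    [set w | X (q%:R / N%:R) w = s q]).
  by apply: fin_bigcap_measurable => // q _; apply: mX; rewrite divr_ge0.
apply/seteqP; split=> w /=.
  by move=> <- q _; rewrite ffunE.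
by move=> H; apply/ffunP => q; rewrite ffunE; exact: H.
Qed.

Definition states_sum N (s : {ffun 'I_N.+1 -> 'I_n}) : R :=
  N%:R^-1 * \sum_(q < N) b (s (widen_ord (leqnSn N) q)).

Lemma weighted_sum_states N w : (0 < N)%N ->
  weighted_sum (sampled X N) b w = states_sum N (channel_states X N w).
Proof.
move=> N0; rewrite weighted_sum_sampled//; congr (_ * _).
by apply: eq_bigr => q _; rewrite ffunE.
Qed.

Lemma measurable_weighted_sum_sampled N : (0 < N)%N ->
  measurable_fun setT (weighted_sum (sampled X N) b).
Proof.
move=> N0; rewrite (_ : weighted_sum _ _ = fun w => \sum_s
    states_sum N s * \1_[set w | channel_states X N w = s] w).
  apply: measurable_sum => s; apply: measurable_funM => //.
  by apply: measurable_indic; exact: discrete_rv_channel_states.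
apply/funext => w; rewrite weighted_sum_states//.
rewrite (bigD1 (channel_states X N w))//= big1 ?addr0.
  by rewrite indicE mem_set ?mulr1.
by move=> s /eqP sw; rewrite indicE memNset ?mulr0//= => /esym.
Qed.

Lemma measurable_weighted_sum : measurable_fun setT (weighted_sum X b).
Proof.
apply: (@measurable_fun_cvg _ _ _ _ (fun N => weighted_sum (sampled X N.+1) b)) => [N|].
  exact: measurable_weighted_sum_sampled.
by move=> w _; rewrite (cvg_shiftS (fun N => weighted_sum (sampled X N) b w)); exact: weighted_sum_cvg.
Qed.

Lemma weighted_sum_sampled_bounds N w (lo hi : R) : (0 < N)%N ->
  (forall k, lo <= b k <= hi) -> lo <= weighted_sum (sampled X N) b w <= hi.
Proof.
move=> N0 lohi; have N0' : 0 < N%:R :> R by rewrite ltr0n.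
have cstE (u : R) : u = N%:R^-1 * \sum_(q < N) u.
  by rewrite sumr_const card_ord -[u *+ N]mulr_natl mulKf// gt_eqF.
rewrite weighted_sum_sampled// [lo]cstE [X in _ <= _ <= X]cstE !ler_pM2l ?invr_gt0//.
by apply/andP; split; apply: ler_sum => q _; have /andP[] := lohi (X (q%:R / N%:R) w).
Qed.

Lemma weighted_sum_bounds w (lo hi : R) :
  (forall k, lo <= b k <= hi) -> lo <= weighted_sum X b w <= hi.
Proof.
move=> lohi; have cv := weighted_sum_cvg X_right b w.
have icv : cvgn (fun N => weighted_sum (sampled X N) b w) by apply/cvg_ex; eexists; exact: cv.
have near1 : \forall N \near \oo, lo <= weighted_sum (sampled X N) b w <= hi.
  by exists 1%N => // N /= N0; exact: weighted_sum_sampled_bounds.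
apply/andP; split; rewrite -(cvg_lim _ cv)//.
  by apply: limr_ge => //; apply: filterS near1 => N /andP[].
by apply: limr_le => //; apply: filterS near1 => N /andP[].
Qed.

(** The sampled sum involves only times q/N < 1, so it is [b (X 0 w)] for every positive N, and so
    is its limit. *)
Lemma weighted_sum_constant w : (forall t, 0 <= t < 1 -> X t w = X 0 w) ->
  \forall N \near \oo, weighted_sum (sampled X N) b w = weighted_sum X b w.
Proof.
move=> Xw.
have E N : (0 < N)%N -> weighted_sum (sampled X N) b w = b (X 0 w).
  move=> N0; have N0' : 0 < N%:R :> R by rewrite ltr0n.
  rewrite weighted_sum_sampled//; transitivity (N%:R^-1 * \sum_(q < N) b (X 0 w)).
    congr (_ * _); apply: eq_bigr => q _.
    by rewrite Xw// divr_ge0//= ltr_pdivrMr// mul1r ltr_nat.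
  by rewrite sumr_const card_ord -[b (X 0 w) *+ N]mulr_natl mulKf// gt_eqF.
have -> : weighted_sum X b w = b (X 0 w).
  have cv := weighted_sum_cvg X_right b w.
  rewrite -(cvg_lim _ cv)//; apply: cvg_lim => //; apply: cvg_near_cst.
  by exists 1%N.
by exists 1%N.
Qed.

End weighted_sum_measurable.

Lemma integral_discrete_rv {R : realType} {d : measure_display} {T : measurableType d}
    (P : probability T R) (F : finType) (f : T -> F) (B : pred F) (g : F -> R) :
  discrete_rv f -> (forall y, 0 <= g y) ->
  (\int[P]_(w in [set w | B (f w)]) (g (f w))%:E =
   (\sum_(y | B y) fine (P [set w | f w = y]) * g y)%:E)%E.
Proof.
move=> mf g0; have mB := measurable_discrete_rv F f B mf.
transitivity (\int[P]_(w in [set w | B (f w)])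
    \sum_(y : F) ((g y)%:E * (\1_[set w | f w = y] w)%:E))%E.
  apply: eq_integral => w _; rewrite (bigD1 (f w))//= big1.
    by rewrite adde0 indicE mem_set ?mule1.
  by move=> y /eqP yw; rewrite indicE memNset ?mule0//= => /esym.
rewrite ge0_integral_sum//=; last 2 first.
- move=> y; apply: emeasurable_funM => //; apply/measurable_EFinP.
  by apply: measurable_indic; exact: mf.
- by move=> y w _; rewrite -EFinM lee_fin mulr_ge0.
rewrite -sumEFin [RHS]big_mkcond/=; apply: eq_bigr => y _.
rewrite ge0_integralZl ?lee_fin//=; last first.
  by apply/measurable_EFinP; apply: measurable_indic; exact: mf.
rewrite (integral_indic _ mB (mf y)).
case: ifPn => By.
  rewrite EFinM -probability_fine; last exact: mf.
  rewrite muleC; congr (P _ * _)%E; apply/seteqP; split=> w //=; first by case.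
  by move=> wy; split=> //; rewrite wy.
rewrite (_ : _ `&` _ = set0) ?measure0 ?mule0//.
by apply/seteqP; split=> w //= [->]; apply/negP.
Qed.

Lemma joint_df_integral {R : realType} {d : measure_display} {T : measurableType d}
    {P : probability T R} {n : nat} {Z : R -> T -> 'I_n} {b : 'I_n -> R} {i j : 'I_n}
    {G : {measure set (measurableTypeR R) -> \bar R}} {lo hi : R} {f : R -> R} :
  has_joint_df P Z b i j G ->
  measurable [set w | Z 0 w = i] -> measurable [set w | Z 1 w = j] ->
  measurable_fun setT (weighted_sum Z b) ->
  (forall w, lo <= weighted_sum Z b w <= hi) ->
  measurable_fun setT f -> (forall x, 0 <= f x) ->
  (\int[G]_(x in `[lo, hi]) (f x)%:E =
   ((fine (P [set w | Z 0%R w = i]))^-1)%:E *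
   \int[P]_(w in [set w | Z 1%R w = j] `&` [set w | Z 0%R w = i])
      (f (weighted_sum Z b w))%:E)%E.
Proof.
move=> GE m0 m1 mV Vb mf f0.
have c0 : 0 <= (fine (P [set w | Z 0 w = i]))^-1 by rewrite invr_ge0 fine_probability_ge0.
have mA := measurableI _ _ m1 m0.
apply: (integral_df P mV mA (NngNum c0)) => //=.
- move=> x; rewrite GE /cprob.
  have mVx : measurable [set w | weighted_sum Z b w <= x].
    by rewrite -[X in measurable X]setTI; apply: measurable_fun_le.
  have -> : [set w | weighted_sum Z b w <= x /\ Z 1 w = j] `&` [set w | Z 0 w = i] =
      [set w | weighted_sum Z b w <= x] `&` ([set w | Z 1 w = j] `&` [set w | Z 0 w = i]).
    by rewrite setIA.
  rewrite [in RHS](probability_fine _ (measurableI _ _ mVx mA)).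
  by rewrite -EFinM mulrC.
- by apply/measurable_EFinP.
Qed.

(** * From a fixed state sequence to the failure probability *)

Section coding_bound.
Context {R : realType} {d : measure_display} {T : measurableType d}
  {P : probability T R} {n N M : nat} {Q : 'M[R]_n.+1} {X : R -> T -> 'I_n.+1}
  {eps : 'I_n.+1 -> R} {rho rate : R}.
Hypotheses (hX : is_ctmc P Q X) (eps0 : forall k, 0 <= eps k)
  (eps_lt : {homo eps : k l / (k < l)%N >-> k < l})
  (eps_half : eps ord_max <= 2^-1) (rho01 : 0 < rho < 1) (rate0 : 0 < rate)
  (N0 : (0 < N)%N) (hM : M%:R = expR (N%:R * rate)).

Let b := bcoef eps rho.

Let N0' : 0 < N%:R :> R. Proof. by rewrite ltr0n. Qed.

(** Since M = e^(NR), the factor M^rho joins the exponent and gives exp(-N(W_N - rho R)). A positive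
    rate ensures M > 1. *)
Lemma gallager_bound_gN (s : {ffun 'I_N.+1 -> 'I_n.+1})
    (dec : word N -> codebook M N -> 'I_M) m :
  (forall (c : codebook M N) y k,
    likelihood eps s (c k) y <= likelihood eps s (c (dec y c)) y) ->
  \sum_(c : codebook M N) \sum_(y : word N)
     2^-1 ^+ (M * N) * (likelihood eps s (c m) y * (dec y c != m)%:R) <=
  gN rho rate N (states_sum b N s).
Proof.
move=> dec_ml.
have M1 : (1 < M)%N by rewrite -(ltr_nat R) hM expR_gt1 mulr_gt0.
apply: le_trans (gallager_bound eps0 eps_lt eps_half rho01 s dec m M1 dec_ml) _.
rewrite /gN hM /powR gt_eqF ?expR_gt0// expRK -expRD /states_sum.
set S := \sum_(q < N) _.
have -> : - (N%:R * (N%:R^-1 * S - rho * rate)) = rho * (N%:R * rate) - S.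
  by rewrite mulrBr mulVKf ?gt_eqF// opprB mulrCA.
exact: lexx.
Qed.

(** Failure is split over the joint values of message, codebook, states and output. Their law is a
    product, so Gallager's bound applies for each message and state sequence; it is the same for all
    messages, whose probabilities sum to 1. *)
Lemma failure_prob_le (i j : 'I_n.+1) (msg : T -> 'I_M) (cb : T -> codebook M N)
    (Y : T -> word N) (dec : codebook M N -> {ffun 'I_N.+1 -> 'I_n.+1} -> word N -> 'I_M) :
  random_coding P eps (channel_states X N) msg cb Y -> is_ml_decoder eps dec ->
  ((failure_prob P (channel_states X N) msg cb Y dec i j)%:E <=
   ((fine (P [set w | X 0%R w = i]))^-1)%:E *
   \int[P]_(w in [set w | X 1%R w = j] `&` [set w | X 0%R w = i])
      (gN rho rate N (weighted_sum (sampled X N) b w))%:E)%E.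
Proof.
move=> [[mmsg mcb mY] cbE indep channel] dec_ml.
set St := channel_states X N.
have mSt : discrete_rv St by exact: (discrete_rv_channel_states hX).
have St0 w : St w ord0 = X 0 w by rewrite /St ffunE mul0r.
have St1 w : St w ord_max = X 1 w by rewrite /St ffunE divff// gt_eqF.
pose Bs (s : {ffun 'I_N.+1 -> 'I_n.+1}) := (s ord_max == j) && (s ord0 == i).
have -> : [set w | X 1 w = j] `&` [set w | X 0 w = i] = [set w | Bs (St w)].
  apply/seteqP; split=> w /=; rewrite /Bs St0 St1.
    by move=> [-> ->]; rewrite !eqxx.
  by move=> /andP[/eqP -> /eqP ->].
under eq_integral do rewrite (weighted_sum_states b)//.
rewrite (integral_discrete_rv P _ St Bs (fun s => gN rho rate N (states_sum b N s)))//; last first.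
  by move=> s; exact: gN_ge0.
rewrite -EFinM lee_fin /failure_prob /cprob.
have -> : [set w | St w ord0 = i] = [set w | X 0 w = i] by apply/seteqP; split=> w /=; rewrite St0.
rewrite mulrC ler_wpM2l ?invr_ge0 ?fine_probability_ge0//.
pose E := ('I_M * codebook M N * {ffun 'I_N.+1 -> 'I_n.+1} * word N)%type.
pose f w : E := (msg w, cb w, St w, Y w).
have fE v : [set w | f w = v] = [set w | [/\ msg w = v.1.1.1, cb w = v.1.1.2, St w = v.1.2 & Y w = v.2]].
  by case: v => [[[m c] s] y]; apply/seteqP; split=> w /=; [case=> -> -> -> ->|case=> <- <- <- <-].
have mf : discrete_rv f.
  move=> v; rewrite fE (_ : mkset _ = [set w | msg w = v.1.1.1] `&` [set w | cb w = v.1.1.2] `&`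
     [set w | St w = v.1.2] `&` [set w | Y w = v.2]).
    by apply: measurableI => //; apply: measurableI => //; apply: measurableI.
  by apply/seteqP; split=> w /=; [case|case=> [[[]]]].
pose Bf (v : E) := (dec v.1.1.2 v.1.2 v.2 != v.1.1.1) && Bs v.1.2.
have -> : [set w | dec (cb w) (St w) (Y w) != msg w /\ St w ord_max = j] `&` [set w | X 0 w = i] =
    setT `&` [set w | Bf (f w)].
  rewrite setTI; apply/seteqP; split=> w /=; rewrite /Bf /Bs /= St0.
    by move=> [[-> ->] ->]; rewrite !eqxx.
  by move=> /andP[-> /andP[/eqP -> /eqP ->]].
rewrite (probability_partition Bf measurableT mf).
pose pm m := fine (P [set w | msg w = m]).
pose ps s := fine (P [set w | St w = s]).
have fv v : fine (P (setT `&` [set w | f w = v])) =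
    pm v.1.1.1 * 2^-1 ^+ (M * N) * ps v.1.2 * likelihood eps v.1.2 (v.1.1.2 v.1.1.1) v.2.
  rewrite setTI fE channel indep cbE (probability_fine _ (mmsg _)) (probability_fine _ (mSt _)).
  by rewrite -!EFinM.
have pm1 : \sum_m pm m = 1.
  have := probability_partition xpredT measurableT mmsg (P := P).
  under eq_bigr do rewrite setTI.
  rewrite /pm => <-; rewrite (_ : _ `&` _ = setT) ?probability_setT//.
  by apply/seteqP; split.
rewrite big_mkcond/=.
pose F (m : 'I_M) (c : codebook M N) (s : {ffun 'I_N.+1 -> 'I_n.+1}) (y : word N) : R :=
  pm m * ps s * (Bs s)%:R *
  (2^-1 ^+ (M * N) * (likelihood eps s (c m) y * (dec c s y != m)%:R)).
have -> : \sum_(v : E) (if Bf v then fine (P (setT `&` [set w | f w = v])) else 0) =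
    \sum_m \sum_c \sum_s \sum_y F m c s y.
  rewrite !pair_bigA/=; apply: eq_bigr => v _; rewrite fv /Bf /F.
  by case: (_ != _); case: (Bs _); rewrite /= ?mulr1 ?mulr0 ?mul0r//; ring.
apply: (@le_trans _ _ (\sum_m \sum_s pm m * ps s * (Bs s)%:R * gN rho rate N (states_sum b N s))).
  apply: ler_sum => m _; rewrite exchange_big/=; apply: ler_sum => s _.
  under eq_bigr do rewrite -mulr_sumr.
  rewrite -mulr_sumr ler_wpM2l//.
    by rewrite !mulr_ge0 ?fine_probability_ge0.
  by apply: (gallager_bound_gN s (fun y c => dec c s y) m) => c y k; exact: dec_ml.
rewrite exchange_big/= [leRHS]big_mkcond/=; apply: ler_sum => s _.
under eq_bigr do rewrite -!mulrA.
rewrite -mulr_suml pm1 mul1r /ps.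
by case: (Bs s); rewrite ?mul1r ?mul0r ?mulr0.
Qed.

End coding_bound.

Lemma cvg_integral_gN {R : realType} {d : measure_display} {T : measurableType d}
    (P : probability T R) (rho rate : R) (A : set T) (V : nat -> T -> R) (W : T -> R) :
  measurable A -> (forall N, measurable_fun setT (V N)) -> measurable_fun setT W ->
  {ae P, forall w, gN rho rate N (V N w) @[N --> \oo] --> glim rho rate (W w)} ->
  (\int[P]_(w in A) (gN rho rate N (V N w))%:E)%E @[N --> \oo] -->
  (\int[P]_(w in A) (glim rho rate (W w))%:E)%E.
Proof.
move=> mA mV mW VW.
have mg N : measurable_fun A (fun w => (gN rho rate N (V N w))%:E : \bar R).
  apply/measurable_EFinP; apply: measurable_funTS.
  by apply: measurableT_comp => //; exact: measurable_gN.
have mgl : measurable_fun A (fun w => (glim rho rate (W w))%:E : \bar R).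
  apply/measurable_EFinP; apply: measurable_funTS.
  by apply: measurableT_comp => //; exact: measurable_glim.
have I1 : P.-integrable A (cst 1%E) by exact: finite_measure_integrable_cst.
have le1 w N : A w -> (`|(gN rho rate N (V N w))%:E| <= cst 1%E w :> \bar R)%E.
  by move=> _; rewrite abse_EFin lee_fin ger0_norm ?gN_ge0// gN_le1.
have cv : {ae P, forall w, A w ->
    (gN rho rate N (V N w))%:E @[N --> \oo] --> ((glim rho rate (W w))%:E : \bar R)}.
  by apply: filterS VW => w Vw _; apply/fine_cvgP; split; [exact: nearW|exact: Vw].
by have [_ _] := dominated_convergence mA mg mgl cv I1 (aeW P le1).
Qed.

Theorem proposition4 (R : realType) (n : nat) (Q : 'M[R]_n.+1)
    (d : measure_display) (T : measurableType d) (P : probability T R)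
    (X : R -> T -> 'I_n.+1) (eps : 'I_n.+1 -> R) (rho rate : R)
    (i j : 'I_n.+1)
    (G : {measure set (measurableTypeR R) -> \bar R})
    (GN : nat -> {measure set (measurableTypeR R) -> \bar R})
    (hX : is_ctmc P Q X)
    (heps0 : forall k, 0 <= eps k)
    (heps : {homo eps : k l / (k < l)%N >-> k < l})
    (heps_half : eps ord_max <= 2^-1)
    (hrho : 0 < rho < 1) (hrate : 0 < rate)
    (hi : (0 < P [set w | X 0%R w = i])%E)
    (hG : has_joint_df P X (bcoef eps rho) i j G)
    (hGN : forall N, (0 < N)%N ->
       has_joint_df P (sampled X N) (bcoef eps rho) i j (GN N)) :
  let b := bcoef eps rho in
  let g_N := gN rho rate in
  let g := glim rho rate in
  [/\ (forall (N M : nat), (0 < N)%N -> M%:R = expR (N%:R * rate) ->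
         forall (msg : T -> 'I_M) (cb : T -> codebook M N) (Y : T -> word N)
           (dec : codebook M N -> {ffun 'I_N.+1 -> 'I_n.+1} -> word N -> 'I_M),
         random_coding P eps (channel_states X N) msg cb Y ->
         is_ml_decoder eps dec ->
         ((failure_prob P (channel_states X N) msg cb Y dec i j)%:E <=
          \int[GN N]_(x in `[b ord_max, b ord0]) (g_N N x)%:E)%E),
      (fun N => \int[GN N]_(x in `[b ord_max, b ord0]) (g_N N x)%:E)%E
        @ \oo --> (\int[G]_(x in `[b ord_max, b ord0]) (g x)%:E)%E &
      (fun N => \int[G]_(x in `[b ord_max, b ord0]) (g_N N x)%:E)%E
        @ \oo --> (\int[G]_(x in `[b ord_max, b ord0]) (g x)%:E)%E].
Proof.
move=> b g_N g.
have [_ mX X_right _] := hX.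
have bE := bcoef_bounds heps0 heps heps_half hrho.
have binj := bcoef_inj heps0 heps heps_half hrho.
pose W := weighted_sum X b; pose W_ N := weighted_sum (sampled X N) b.
pose A := [set w | X 1 w = j] `&` [set w | X 0 w = i].
pose p := (fine (P [set w | X 0 w = i]))^-1.
have mA : measurable A by apply: measurableI; exact: mX.
have mW : measurable_fun setT W by exact: (measurable_weighted_sum hX).
have mW_ N : (0 < N)%N -> measurable_fun setT (W_ N).
  exact: (measurable_weighted_sum_sampled hX).
have sampled0 N : sampled X N 0 = X 0 by rewrite /sampled mulr0 floor0 mul0r.
have sampled1 N : (0 < N)%N -> sampled X N 1 = X 1.
  by move=> N0; rewrite /sampled mulr1 [N%:R]pmulrn intrKfloor divff// intr_eq0 -lt0n.
have GE (f : R -> R) : measurable_fun setT f -> (forall x, 0 <= f x) ->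
    (\int[G]_(x in `[b ord_max, b ord0]) (f x)%:E =
     p%:E * \int[P]_(w in A) (f (W w))%:E)%E.
  move=> mf f0; apply: (joint_df_integral hG) => //; try exact: mX.
  by move=> w; exact: (weighted_sum_bounds hX).
have GNE N (f : R -> R) : (0 < N)%N -> measurable_fun setT f -> (forall x, 0 <= f x) ->
    (\int[GN N]_(x in `[b ord_max, b ord0]) (f x)%:E =
     p%:E * \int[P]_(w in A) (f (W_ N w))%:E)%E.
  move=> N0 mf f0.
  rewrite (joint_df_integral (hGN N N0)) ?sampled0 ?sampled1//; try exact: mX.
    exact: mW_.
  by move=> w; exact: weighted_sum_sampled_bounds.
split.
- move=> N M N0 hM msg cb Y dec code dec_ml.
  rewrite GNE//; [|exact: measurable_gN|exact: gN_ge0].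
  exact: (failure_prob_le hX heps0 heps heps_half hrho hrate N0 hM i j _ _ _ _ code dec_ml).
- rewrite GE; [|exact: measurable_glim|exact: glim_ge0].
  (* Index 0 gets a measurable placeholder, harmless for the limit. *)
  pose V N := if N is 0%N then W else W_ N.
  rewrite -cvg_shiftS.
  under eq_fun do rewrite (GNE _ _ (ltn0Sn _) (measurable_gN _ _ _) (gN_ge0 _ _ _)).
  suff : (p%:E * \int[P]_(w in A) (g_N N (V N w))%:E)%E @[N --> \oo] -->
      (p%:E * \int[P]_(w in A) (g (W w))%:E)%E by rewrite -cvg_shiftS.
  apply: cvgeZl => //; apply: cvg_integral_gN => //.
    by case=> [|N]; [exact: mW|exact: mW_].
  (* Off this null set, either the limit avoids the discontinuity of [g], or the path is constant
     before time 1 and the sampled sums equal their limit. *)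
  have [B [mB B0 HB]] := negligible_atom hX b (rho * rate) binj.
  exists B; split=> // w /= nw; apply: HB => /=; apply: contrapT => /not_andP Hw; apply: nw.
  have VW : V N w @[N --> \oo] --> W w.
    have := weighted_sum_cvg X_right b w; rewrite -cvg_shiftS => cv.
    by rewrite -cvg_shiftS; exact: cv.
  apply: gN_cvg => // Wc; case: Hw => // /forall2NP Xw.
  have : \forall N \near \oo, W_ N w = W w.
    apply: (weighted_sum_constant hX) => t t01.
    by case: (Xw t) => // /contrapT.
  by case=> N0 _ HN; exists N0.+1 => // -[//|N] N0N; apply: HN => /=; exact: ltnW.
- rewrite GE; [|exact: measurable_glim|exact: glim_ge0].
  under eq_fun do rewrite (GE _ (measurable_gN _ _ _) (gN_ge0 _ _ _)).
  apply: cvgeZl => //; apply: cvg_integral_gN => //.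
  (* The sequence is constant here, so an atom at the discontinuity does no harm. *)
  by apply: aeW => w; apply: gN_cvg; [exact: cvg_cst|move=> _; exact: nearW].
Qed.
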